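(* There is an algorithm that computes a real number $x$ such that for each integer $b\geq 2$, \[ \limsup_{N \to \infty} \frac{D_N\big( (\{b^j x\})_{j\geq 0}\big) \sqrt{N}}{\sqrt{\log \log N}} < 3 C_b,\qquad\text{where } C_b= 166 + \frac{664}{\sqrt{b}-1}. \] The algorithm computes the first $n$ digits of the expansion of $x$ in base $2$ after performing a number of mathematical operations that is triple-exponential in $n$.
   Context: For a real number $y$, $\{y\}=y-\lfloor y\rfloor$ is its fractional part. For a sequence $(x_j)_{j\geq 1}$ of real numbers in the unit interval, the discrepancy of the first $N$ elements is \[ D_N((x_j)_{j\geq 1})= \sup_{0\leq u< v\leq 1} \left| \frac{\#\{ j : 1\leq j \leq N \text{ and } u\leq x_j < v\}}{N} - (v-u) \right|. \] For a sequence indexed from $j=0$, the first $N$ elements are those with indices $0,1,\ldots,N-1$. $\log$ is the natural logarithm. ''The algorithm computes $x$'' means that it outputs, one after the other, the digits $d_1,d_2,\ldots\in\{0,1\}$ of the binary expansion $x=0.d_1d_2d_3\ldots$ (in particular $x$ is a single real number, the same for all bases $b$). ''Mathematical operations'' are elementary operations of discrete mathematics (on integers, rationals and finite strings of digits), and ''triple-exponential in $n$'' means bounded by $2^{2^{2^{cn}}}$ for some constant $c>0$ and all $n\ge 1$. *)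

(* Defs.v *)
From HB Require Import structures.
From mathcomp Require Import all_boot all_order all_algebra.
From mathcomp Require Import all_classical all_reals all_analysis.
Set Implicit Arguments.
Unset Strict Implicit.
Unset Printing Implicit Defensive.
Import Order.TTheory GRing.Theory Num.Theory.
Import numFieldNormedType.Exports.
Local Open Scope ring_scope.

(** * Algorithms

    Algorithms are programs of an imperative language with an unbounded supply
    of registers of three sorts: integers, rational numbers and finite strings
    of digits.  A digit is stored as an integer, so that one sort of string
    serves every base.  An instruction performs a single elementary operation
    on registers, and the number of operations performed is the number of
    machine steps; tests, output and sequencing are counted too. *)

Inductive int_op := IAdd | ISub | IMul | IDiv | IMod | ILe | IEq.
Inductive rat_op := RAdd | RSub | RMul | RDiv.
Inductive rat_test := RLe | REq.

Inductive instr :=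
| IConst (x : nat) (c : int)                  (* x := c *)
| IOp (op : int_op) (x y z : nat)             (* x := y op z *)
| RFrac (q : nat) (y z : nat)                 (* q := y / z *)
| ROp (op : rat_op) (q r s : nat)             (* q := r op s *)
| RTest (t : rat_test) (x : nat) (q r : nat)  (* x := 1 if q t r, else 0 *)
| RNum (x : nat) (q : nat)                    (* x := numerator of q *)
| RDen (x : nat) (q : nat)                    (* x := denominator of q *)
| SEmpty (w : nat)                            (* w := empty string *)
| SPush (w v : nat) (y : nat)                 (* w := v followed by y *)
| SCat (w v u : nat)                          (* w := v followed by u *)
| STake (w v : nat) (y : nat)                 (* w := first y digits of v *)
| SDrop (w v : nat) (y : nat)                 (* w := v minus its first y digits *)
| SLen (x : nat) (w : nat)                    (* x := length of w *)
| SNth (x : nat) (w : nat) (y : nat).         (* x := digit of index y in w *)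

Inductive cmd :=
| Instr (i : instr)
| Emit (x : nat)
| Seq (p q : cmd)
| If (x : nat) (p q : cmd)
| While (x : nat) (p : cmd).

Record store := Store {
  ireg : nat -> int;
  rreg : nat -> rat;
  sreg : nat -> seq int }.

Definition upd (T : Type) (f : nat -> T) (i : nat) (v : T) : nat -> T :=
  fun j => if j == i then v else f j.

Definition iset (s : store) x v := Store (upd (ireg s) x v) (rreg s) (sreg s).
Definition rset (s : store) q v := Store (ireg s) (upd (rreg s) q v) (sreg s).
Definition sset (s : store) w v := Store (ireg s) (rreg s) (upd (sreg s) w v).

(* [IDiv] and [IMod] are Euclidean division.  Division by zero is total, as in
   the library. *)
Definition int_op_eval (op : int_op) (m n : int) : int :=
  match op with
  | IAdd => m + n
  | ISub => m - n
  | IMul => m * n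
  | IDiv => (m %/ n)%Z
  | IMod => (m %% n)%Z
  | ILe => Posz (m <= n)%R
  | IEq => Posz (m == n)
  end.

Definition rat_op_eval (op : rat_op) (q r : rat) : rat :=
  match op with
  | RAdd => q + r
  | RSub => q - r
  | RMul => q * r
  | RDiv => q / r
  end.

Definition rat_test_eval (t : rat_test) (q r : rat) : bool :=
  match t with
  | RLe => q <= r
  | REq => q == r
  end.

(* Negative positions in a string are read as 0. *)
Definition pos_of_int (m : int) : nat := if m is Posz n then n else 0%N.

Definition exec (i : instr) (s : store) : store :=
  match i with
  | IConst x c => iset s x c
  | IOp op x y z => iset s x (int_op_eval op (ireg s y) (ireg s z))
  | RFrac q y z => rset s q ((ireg s y)%:~R / (ireg s z)%:~R)
  | ROp op q r t => rset s q (rat_op_eval op (rreg s r) (rreg s t))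
  | RTest t x q r => iset s x (Posz (rat_test_eval t (rreg s q) (rreg s r)))
  | RNum x q => iset s x (numq (rreg s q))
  | RDen x q => iset s x (denq (rreg s q))
  | SEmpty w => sset s w [::]
  | SPush w v y => sset s w (rcons (sreg s v) (ireg s y))
  | SCat w v u => sset s w (sreg s v ++ sreg s u)
  | STake w v y => sset s w (take (pos_of_int (ireg s y)) (sreg s v))
  | SDrop w v y => sset s w (drop (pos_of_int (ireg s y)) (sreg s v))
  | SLen x w => iset s x (size (sreg s w))%:Z
  | SNth x w y => iset s x (nth 0 (sreg s w) (pos_of_int (ireg s y)))
  end.

(* [todo] lists the commands that remain to be executed, the next one first. *)
Record config := Config {
  todo : seq cmd;
  mem : store;
  output : seq bool }.

Definition step (g : config) : config :=
  let s := mem g in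
  let o := output g in
  match todo g with
  | [::] => g
  | Instr i :: k => Config k (exec i s) o
  | Emit x :: k => Config k s (rcons o (ireg s x != 0))
  | Seq p q :: k => Config (p :: q :: k) s o
  | If x p q :: k => Config ((if ireg s x != 0 then p else q) :: k) s o
  | While x p :: k =>
      Config (if ireg s x != 0 then p :: While x p :: k else k) s o
  end.

Definition init (p : cmd) : config :=
  Config [:: p] (Store (fun=> 0) (fun=> 0) (fun=> [::])) [::].

Definition output_after (p : cmd) (k : nat) : seq bool :=
  output (iter k step (init p)).

(* [d i] is the digit of weight [2 ^- i.+1]. *)
Definition binary_expansion (R : realType) (d : nat -> bool) (x : R) : Prop :=
  (\sum_(0 <= i < n) (d i)%:R / 2 ^+ i.+1 @[n --> \oo] --> x)%classic.

Definition computes (R : realType) (p : cmd) (x : R) : Prop :=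
  exists2 d : nat -> bool, binary_expansion d x &
    forall n, exists k, output_after p k = mkseq d n.

Definition triple_exp_time (R : realType) (p : cmd) : Prop :=
  exists2 c : R, 0 < c &
    forall n : nat, (1 <= n)%N ->
      exists2 k : nat, k%:R <= 2 `^ (2 `^ (2 `^ (c * n%:R))) &
        (n <= size (output_after p k))%N.

(** * Discrepancy *)

Definition frac_part (R : realType) (y : R) : R := y - (Num.floor y)%:~R.

(* The first [N] elements of [u] are [u 0, ..., u (N - 1)]. *)
Definition discrepancy (R : realType) (N : nat) (u : nat -> R) : R :=
  sup [set r : R | exists a b : R, [/\ 0 <= a, a < b, b <= 1 &
    r = `| #|[pred j : 'I_N | a <= u j < b]|%:R / N%:R - (b - a) | ] ]%classic.

Definition lil_const (R : realType) (b : nat) : R :=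
  166 + 664 / (Num.sqrt b%:R - 1).

(* Main.v *)
(** Fix a base [b] and let [a / M] run through the points of a grid whose size
    [M] is divisible by a high power of [b], so that the first digits of
    [a / M] in base [b] are exactly independent and uniform.  An interval
    [[0, v / b ^ H)] is a disjoint union, over the word lengths [h <= H], of
    sets of words of length [h] that have a common prefix of length [h - 1] and
    thus probability at most [b ^ (1 - h)].  For such a set the occurrences at
    the positions of a given residue class modulo [h] form a sequence of
    independent trials, and Ville's inequality bounds the maximal deviation;
    the sum over [h] of the bounds is of order [sqrt (N * ln (ln N))].  With
    [2 ^ (2 ^ l) <= N < 2 ^ (2 ^ l.+1)], the number [l] replaces [ln (ln N)],
    the bases [b <= l] are tested at level [l], and the points that fail at
    level [l] have density at most [4 ^ - l].  The constant obtained is smaller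
    than [3 * 166], so neither the value of the constant nor the union bounds
    need care.

    The digits are found by bisection: stage [n] counts, on a common grid, the
    points of each half of the current dyadic interval that fail at a level at
    most [n + 6], and moves to the half with fewer of them.  The proportion of
    failing points stays below 1, so every interval contains a good grid point,
    and the deviation bounds pass to the limit since an orbit of bounded length
    moves by at most one arc of length [b ^ - H].  The grid of stage [n] has
    triple-exponential size, which bounds the number of operations. *)
Require Import Defs.
From HB Require Import structures.
From mathcomp Require Import all_boot all_order all_algebra.
From mathcomp Require Import all_classical all_reals all_analysis.
From mathcomp Require Import zify ring lra.
Set Implicit Arguments.
Unset Strict Implicit.
Unset Printing Implicit Defensive.
Import Order.TTheory GRing.Theory Num.Theory.
Import numFieldNormedType.Exports.
Local Open Scope ring_scope.

(** * A compiler for expressions with bounded loops *)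

Inductive expr :=
| Var (x : nat)
| Cst (c : int)
| Bin (op : int_op) (e f : expr)
| Let (x : nat) (e f : expr)
| Fold (x i : nat) (n e f : expr).

Fixpoint eval (e : expr) (r : nat -> int) : int :=
  match e with
  | Var x => r x
  | Cst c => c
  | Bin op e f => int_op_eval op (eval e r) (eval f r)
  | Let x e f => eval f (upd r x (eval e r))
  | Fold x i n e f =>
      iteri (pos_of_int (eval n r))
        (fun k a => eval f (upd (upd r x a) i k%:Z)) (eval e r)
  end.

Definition move (y x : nat) :=
  Seq (Instr (IConst y 0)) (Instr (IOp IAdd y y x)).

(* Register [u] holds the constant 1: the machine has no strict comparison. *)
Definition set_lt (z x y u : nat) :=
  Seq (Instr (IOp ILe z x y)) (Instr (IOp ISub z u z)).

(* The value of [e] goes to register [d], the registers below [d] are kept,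
   and the variable [x] is read in register [m x]. *)
Fixpoint compile (m : nat -> nat) (d : nat) (e : expr) : cmd :=
  match e with
  | Var x => move d (m x)
  | Cst c => Instr (IConst d c)
  | Bin op e f =>
      Seq (compile m d e)
        (Seq (compile m d.+1 f) (Instr (IOp op d d d.+1)))
  | Let x e f =>
      Seq (compile m d e)
        (Seq (compile (upd m x d) d.+1 f) (move d d.+1))
  | Fold x i n e f =>
      Seq (compile m d n)
     (Seq (compile m d.+1 e)
     (Seq (Instr (IConst d.+2 0))
     (Seq (Instr (IConst d.+3 1))
     (Seq (set_lt d.+4 d d.+2 d.+3)
     (Seq (While d.+4
        (Seq (compile (upd (upd m x d.+1) i d.+2) d.+4.+1 f)
        (Seq (move d.+1 d.+4.+1)
        (Seq (Instr (IOp IAdd d.+2 d.+2 d.+3))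
           (set_lt d.+4 d d.+2 d.+3)))))
        (move d d.+1))))))
  end.

Fixpoint cost (e : expr) (r : nat -> int) : nat :=
  match e with
  | Var _ => 3
  | Cst _ => 1
  | Bin _ e f => (cost e r + cost f r + 3)%N
  | Let x e f => (cost e r + cost f (upd r x (eval e r)) + 5)%N
  | Fold x i n e f =>
      (cost n r + cost e r + 15 +
       \sum_(k < pos_of_int (eval n r))
         (cost f (upd (upd r x
            (iteri k (fun k a => eval f (upd (upd r x a) i k%:Z)) (eval e r)))
            i k%:Z) + 11))%N
  end.

(** The continuation [k] is arbitrary so that runs compose; the same output [o] on both sides
    restricts the notion to code that emits nothing. *)
Definition runs (c : cmd) (s s' : store) (t : nat) :=
  forall k o, iter t step (Config (c :: k) s o) = Config k s' o.

Lemma iter_add (T : Type) (f : T -> T) m n x :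
  iter (m + n) f x = iter n f (iter m f x).
Proof. by rewrite addnC iterD. Qed.

Lemma runs_instr i s : runs (Instr i) s (exec i s) 1.
Proof. by []. Qed.

Lemma runs_seq c c' s s' s'' t t' :
  runs c s s' t -> runs c' s' s'' t' -> runs (Seq c c') s s'' (t + t').+1.
Proof.
move=> h h' k o; rewrite iterSr /= iter_add.
by rewrite [X in iter t' _ X]h h'.
Qed.

Lemma runs_while0 x c s : ireg s x = 0 -> runs (While x c) s s 1.
Proof. by move=> h k o /=; rewrite /step /= h. Qed.

Lemma runs_whileS x c s s' s'' t t' :
  ireg s x != 0 -> runs c s s' t -> runs (While x c) s' s'' t' ->
  runs (While x c) s s'' (t + t').+1.
Proof.
move=> x0 h h' k o; rewrite iterSr iter_add [step _]/step /= x0.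
by rewrite h h'.
Qed.

Lemma updE (T : Type) (f : nat -> T) i v j :
  upd f i v j = if j == i then v else f j.
Proof. by []. Qed.

Lemma runs_move y x s : x != y ->
  exists2 s', runs (move y x) s s' 3 & ireg s' = upd (ireg s) y (ireg s x).
Proof.
move=> xy; exists (exec (IOp IAdd y y x) (exec (IConst y 0) s)).
  exact: (runs_seq (runs_instr _ _) (runs_instr _ _)).
apply/funext => j /=; rewrite !updE eqxx (negbTE xy) add0r.
by case: eqP.
Qed.

Lemma runs_set_lt z x y u s : u != z -> ireg s u = 1 ->
  exists2 s', runs (set_lt z x y u) s s' 3 &
    ireg s' = upd (ireg s) z (Posz (ireg s y < ireg s x)%R).
Proof.
move=> uz hu; exists (exec (IOp ISub z u z) (exec (IOp ILe z x y) s)).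
  exact: (runs_seq (runs_instr _ _) (runs_instr _ _)).
apply/funext => j /=; rewrite !updE eqxx (negbTE uz) hu ltNge.
by case: eqP => // _; case: (_ <= _).
Qed.

Lemma upd_comp (m : nat -> nat) (r r' : nat -> int) (x y : nat) (v : int) :
  (forall z, r' (m z) = r (m z)) -> r' y = v ->
  r' \o upd m x y = upd (r \o m) x v.
Proof.
by move=> h hy; apply/funext => z; rewrite /= !updE; case: eqP.
Qed.

Local Ltac dif := try lia; repeat (rewrite ?eqxx ifF; last lia); rewrite ?eqxx //; try lia.

(** Induction on [e], with [d] as the top of a stack: [m] sends every variable below [d], so
    intermediate values, kept at [d] and above, never overwrite a variable in use. *)
Lemma compileP e m d s : (forall x, (m x < d)%N) ->
  exists s', [/\ runs (compile m d e) s s' (cost e (ireg s \o m)),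
    ireg s' d = eval e (ireg s \o m) &
    forall r, (r < d)%N -> ireg s' r = ireg s r].
Proof.
elim: e m d s => [x|c|op e IHe f IHf|x e IHe f IHf|x i n IHn e IHe f IHf] m d s hm.
- have [|s' h E] := @runs_move d (m x) s; first by rewrite neq_ltn hm.
  exists s'; split => //; first by rewrite E updE eqxx.
  by move=> r rd; rewrite E updE (ltn_eqF rd).
- exists (exec (IConst d c) s); split => //=; first by rewrite updE eqxx.
  by move=> r rd; rewrite updE (ltn_eqF rd).
- have [s1 [r1 v1 k1]] := IHe m d s hm.
  have [s2 [r2 v2 k2]] := IHf m d.+1 s1 (fun z => ltnW (hm z)).
  have E : ireg s1 \o m = ireg s \o m by apply/funext => z /=; rewrite k1.
  rewrite E in r2 v2.
  exists (exec (IOp op d d d.+1) s2); split.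
  + rewrite /= (_ : (_ + 3)%N = (cost e (ireg s \o m) + (cost f (ireg s \o m) + 1).+1).+1); last lia.
    exact: (runs_seq r1 (runs_seq r2 (runs_instr _ _))).
  + by rewrite /= updE eqxx v2 k2 // v1.
  + by move=> r rd /=; rewrite updE (ltn_eqF rd) k2 ?k1 // ltnW.
- have [s1 [r1 v1 k1]] := IHe m d s hm.
  have hm' z : (upd m x d z < d.+1)%N.
    by rewrite updE; case: eqP => // _; exact: leqW (hm z).
  have [s2 [r2 v2 k2]] := IHf (upd m x d) d.+1 s1 hm'.
  have E : ireg s1 \o upd m x d = upd (ireg s \o m) x (eval e (ireg s \o m)).
    by apply: upd_comp => // z; rewrite k1.
  rewrite E in r2 v2.
  have [|s3 r3 E3] := @runs_move d d.+1 s2; first by rewrite neq_ltn ltnSn orbT.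
  exists s3; split.
  + rewrite /= (_ : (_ + 5)%N = (cost e (ireg s \o m) + (cost f (upd (ireg s \o m) x (eval e (ireg s \o m))) + 3).+1).+1); last lia.
    exact: (runs_seq r1 (runs_seq r2 r3)).
  + by rewrite E3 updE eqxx v2.
  + by move=> r rd; rewrite E3 updE (ltn_eqF rd) k2 ?k1 // ltnW.
- set r0 := ireg s \o m.
  pose F := fun (k : nat) a => eval f (upd (upd r0 x a) i k%:Z).
  have [s1 [r1 v1 k1]] := IHn m d s hm.
  have [s2 [r2 v2 k2]] := IHe m d.+1 s1 (fun z => ltnW (hm z)).
  have E : ireg s1 \o m = r0 by apply/funext => z /=; rewrite k1.
  rewrite E in r2 v2.
  set nn := pos_of_int (eval n r0).
  (* Loop invariant with [q] rounds left: the bound, the accumulator, the counter, the constant 1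
     and the guard occupy the registers [d] to [d.+4]. *)
  have loop q : forall k s0, (k + q = nn)%N ->
    ireg s0 d = eval n r0 -> ireg s0 d.+1 = iteri k F (eval e r0) ->
    ireg s0 d.+2 = k%:Z -> ireg s0 d.+3 = 1 ->
    ireg s0 d.+4 = Posz (k < nn)%N ->
    (forall r, (r < d)%N -> ireg s0 r = ireg s r) ->
    exists s', [/\ runs (While d.+4
        (Seq (compile (upd (upd m x d.+1) i d.+2) d.+4.+1 f)
        (Seq (move d.+1 d.+4.+1)
        (Seq (Instr (IOp IAdd d.+2 d.+2 d.+3))
           (set_lt d.+4 d d.+2 d.+3))))) s0 s'
          (\sum_(k <= j < nn) (cost f (upd (upd r0 x (iteri j F (eval e r0))) i j%:Z) + 11)).+1,
      ireg s' d.+1 = iteri nn F (eval e r0) &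
      forall r, (r < d)%N -> ireg s' r = ireg s r].
    elim: q => [|q IHq] k s0 hk hn ha hi h1 hf hr.
      exists s0; split => //; last by rewrite ha -hk addn0.
      rewrite big_geq; last by rewrite -hk addn0.
      apply: runs_while0; rewrite hf (_ : (k < nn)%N = false) //.
      by rewrite -hk addn0 ltnn.
    have kn : (k < nn)%N by rewrite -hk; lia.
    have hm' z : (upd (upd m x d.+1) i d.+2 z < d.+4.+1)%N.
      rewrite !updE; case: eqP => _; first lia.
      by case: eqP => _; [lia | have := hm z; lia].
    have [t1 [q1 w1 l1]] := IHf (upd (upd m x d.+1) i d.+2) d.+4.+1 s0 hm'.
    have E1 : ireg s0 \o upd (upd m x d.+1) i d.+2 =
        upd (upd r0 x (iteri k F (eval e r0))) i k%:Z.
      apply/funext => z; rewrite /= !updE; case: eqP => // _.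
      by case: eqP => // _; rewrite hr.
    rewrite E1 in q1 w1.
    have [|t2 q2 E2] := @runs_move d.+1 d.+4.+1 t1; first lia.
    pose t3 := exec (IOp IAdd d.+2 d.+2 d.+3) t2.
    have E3 : ireg t3 = upd (ireg t2) d.+2 (k.+1)%:Z.
      rewrite /t3 /= !E2 !updE.
      do 2 (rewrite ifF; last lia).
      rewrite (l1 d.+2) ?(l1 d.+3) //; try lia.
      by rewrite hi h1 -PoszD addn1.
    have V r : (r < d.+4.+1)%N -> ireg t3 r =
        if r == d.+2 then k.+1%:Z else if r == d.+1 then ireg t1 d.+4.+1
        else ireg s0 r.
      by move=> rd; rewrite E3 updE E2 updE; do 2 case: ifP => // _; rewrite l1.
    have [||t4 q4 E4] := @runs_set_lt d.+4 d d.+2 d.+3 t3; first lia.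
      by rewrite V; dif.
    have W r : (r < d.+4)%N -> ireg t4 r = ireg t3 r.
      by move=> rd; rewrite E4 updE (ltn_eqF rd).
    have [||||||| t5 [q5 w5 l5]] := IHq k.+1 t4; first lia.
    + by rewrite W ?V; dif.
    + by rewrite W ?V; dif; rewrite ?w1.
    + by rewrite W ?V; dif.
    + by rewrite W ?V; dif.
    + rewrite E4 updE eqxx !V; dif; rewrite hn /nn.
      congr Posz; congr nat_of_bool; rewrite /pos_of_int.
      by case: (eval n r0).
    + by move=> r rd; rewrite W ?V; dif; apply: hr.
    exists t5; split => //.
    have f0 : ireg s0 d.+4 != 0 by rewrite hf kn.
    have := runs_whileS f0 (runs_seq q1 (runs_seq q2 (runs_seq (runs_instr _ t2) q4))) q5.
    rewrite (big_ltn kn).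
    set u := cost f _; set v := (\sum_(_ <= _ < _) _)%N.
    by rewrite (_ : ((u + (3 + (1 + 3).+1).+1).+1 + v.+1).+1 = (u + 11 + v).+1) //; lia.
  pose s3 := exec (IConst d.+2 0) s2.
  pose s4 := exec (IConst d.+3 1) s3.
  have V r : ireg s4 r = if r == d.+3 then 1 else if r == d.+2 then 0 else ireg s2 r.
    by rewrite /s4 /= updE; case: eqP => // _; rewrite /s3 /= updE.
  have [||s5 q5 E5] := @runs_set_lt d.+4 d d.+2 d.+3 s4; first lia.
    by rewrite V eqxx.
  have W r : (r < d.+4)%N -> ireg s5 r = ireg s4 r.
    by move=> rd; rewrite E5 updE (ltn_eqF rd).
  have [||||||| s6 [q6 w6 l6]] := loop nn 0%N s5; first by [].
  + by rewrite W ?V; dif; rewrite k2 ?v1.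
  + by rewrite W ?V; dif.
  + by rewrite W ?V; dif.
  + by rewrite W ?V; dif.
  + rewrite E5 updE eqxx !V; dif; rewrite k2 ?v1 /nn //.
    by congr Posz; congr nat_of_bool; case: (eval n r0).
  + by move=> r rd; rewrite W ?V; dif; rewrite k2 ?k1 //; lia.
  have [|s7 q7 E7] := @runs_move d d.+1 s6; first lia.
  exists s7; split.
  + have := runs_seq r1 (runs_seq r2 (runs_seq (runs_instr (IConst d.+2 0) s2)
      (runs_seq (runs_instr (IConst d.+3 1) s3) (runs_seq q5 (runs_seq q6 q7))))).
    rewrite /= big_mkord -/nn.
    set u := cost n _; set v := cost e _; set w := (\sum_(_ < _) _)%N.
    by rewrite (_ : (u + (v + (1 + (1 + (3 + (w.+1 + 3).+1).+1).+1).+1).+1).+1 = (u + v + 15 + w)%N) //; lia.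
  + by rewrite E7 updE eqxx w6.
  + by move=> r rd; rewrite E7 updE (ltn_eqF rd) l6.
Qed.

(* The body of a loop is considered for every value [a] of the accumulator, so
   that the predicate can be checked without evaluating the loop. *)
Fixpoint loops_le (B : nat) (e : expr) (r : nat -> int) : Prop :=
  match e with
  | Var _ | Cst _ => True
  | Bin _ e f => loops_le B e r /\ loops_le B f r
  | Let x e f => loops_le B e r /\ loops_le B f (upd r x (eval e r))
  | Fold x i n e f =>
      [/\ loops_le B n r, loops_le B e r, eval n r <= B%:Z &
        forall (k : nat) a, k%:Z < eval n r ->
          loops_le B f (upd (upd r x a) i k%:Z)]
  end.

Fixpoint esize (e : expr) : nat :=
  match e with
  | Var _ | Cst _ => 15
  | Bin _ e f | Let _ e f => (esize e + esize f + 15)%N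
  | Fold _ _ n e f => (esize n + esize e + esize f + 15)%N
  end.

Lemma pos_of_int_lt z (k : nat) : (k < pos_of_int z)%N = (k%:Z < z).
Proof. by case: z. Qed.

(** A loop multiplies the cost of its body by at most [B], which one more power of [B.+1] absorbs;
    the weight 15 in [esize] covers the fixed overheads, the largest of which is 15. *)
Lemma cost_le B e r : loops_le B e r ->
  (cost e r <= esize e * B.+1 ^ esize e)%N.
Proof.
have B1 k : (0 < B.+1 ^ k)%N by rewrite expn_gt0.
have mono j k : (j <= k)%N -> (B.+1 ^ j <= B.+1 ^ k)%N by apply: leq_pexp2l.
elim: e r => [x|c|op e IHe f IHf|x e IHe f IHf|x i n IHn e IHe f IHf] r.
- by move=> _; rewrite (@leq_trans 15) // leq_pmulr.
- by move=> _; rewrite (@leq_trans 15) // leq_pmulr.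
- move=> [/IHe he /IHf hf] /=; rewrite !mulnDl !leq_add //.
  + by apply: leq_trans he _; rewrite leq_mul2l mono ?orbT //; lia.
  + by apply: leq_trans hf _; rewrite leq_mul2l mono ?orbT //; lia.
  + by rewrite (@leq_trans 15) // leq_pmulr.
- move=> [/IHe he /IHf hf] /=; rewrite !mulnDl !leq_add //.
  + by apply: leq_trans he _; rewrite leq_mul2l mono ?orbT //; lia.
  + by apply: leq_trans hf _; rewrite leq_mul2l mono ?orbT //; lia.
  + by rewrite (@leq_trans 15) // leq_pmulr.
- move=> [/IHn hn /IHe he nB hf] /=.
  set S := (esize n + _ + _ + _)%N.
  have hn' : (cost n r <= esize n * B.+1 ^ S)%N.
    by apply: leq_trans hn _; rewrite leq_mul2l mono ?orbT // /S; lia.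
  have he' : (cost e r <= esize e * B.+1 ^ S)%N.
    by apply: leq_trans he _; rewrite leq_mul2l mono ?orbT // /S; lia.
  set Sg := (\sum_(_ < _) _)%N.
  have hs : (Sg <= B * (esize f * B.+1 ^ (esize f) + 11))%N.
    apply: (@leq_trans (\sum_(k < pos_of_int (eval n r)) (esize f * B.+1 ^ (esize f) + 11))%N).
      apply: leq_sum => k _; rewrite leq_add2r; apply: IHf; apply: hf.
      by rewrite -pos_of_int_lt.
    rewrite sum_nat_const card_ord leq_mul2r; apply/orP; right.
    by move: nB; case: (eval n r).
  have hP : (B.+1 * B.+1 ^ (esize f) <= B.+1 ^ S)%N.
    by rewrite -expnS mono // /S; lia.
  have hB : (B.+1 <= B.+1 ^ S)%N by rewrite -{1}(expn1 B.+1) mono // /S; lia.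
  have hS : (Sg + 15 <= (esize f + 15) * B.+1 ^ S)%N.
    apply: leq_trans (_ : esize f * (B.+1 * B.+1 ^ esize f) + 15 * B.+1 <= _)%N.
      by nia.
    by rewrite mulnDl leq_add // leq_mul2l ?hP ?hB ?orbT.
  have : (cost n r + cost e r + (Sg + 15) <= S * B.+1 ^ S)%N.
    move: hn' he' hS; rewrite -!/S; set P := (B.+1 ^ S)%N => hn' he' hS.
    by rewrite /S !mulnDl in hS *; lia.
  by lia.
Qed.

(** * Digit blocks and a maximal inequality *)

(* For [x = a / M], the number whose [h] digits in base [b] are those of
   [b ^ j * x] after the point. *)
Definition wrd (b h M a j : nat) : nat := ((b ^ j * a) %% M * b ^ h) %/ M.

(** Self-similarity of the grid: once shifted out, the leading block [w] contributes a multiple of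
    the modulus. This stands in for the independence of successive digit blocks. *)
Lemma wrd_shift b h r M' w a j : (0 < b)%N ->
  wrd b h (b ^ r * M') (w * M' + a) (r + j) = wrd b h M' a j.
Proof.
move=> b0; rewrite /wrd expnD -mulnA -muln_modr -mulnA divnMl ?expn_gt0 ?b0 //.
by rewrite mulnDr mulnA modnMDl.
Qed.

Lemma wrd_head b h M' w a : (0 < b)%N -> (w < b ^ h)%N -> (a < M')%N ->
  wrd b h (b ^ h * M') (w * M' + a) 0 = w.
Proof.
move=> b0 wB aM; rewrite /wrd expn0 mul1n modn_small; last nia.
by rewrite mulnC divnMl ?expn_gt0 ?b0 // divnMDl ?divn_small ?addn0 //; lia.
Qed.

Lemma wrd_div b h M a j : (0 < b)%N ->
  (wrd b h.+1 M a j %/ b = wrd b h M a j)%N.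
Proof.
by move=> b0; rewrite /wrd -divnMA expnSr mulnA divnMr.
Qed.

Lemma wrd_lt b h M a j : (0 < b)%N -> (0 < M)%N -> (wrd b h M a j < b ^ h)%N.
Proof.
move=> b0 M0; rewrite /wrd ltn_divLR // mulnC ltn_pmul2l ?expn_gt0 ?b0 //.
exact: ltn_pmod.
Qed.

(** * Counting measure on the grid and tail bounds *)

Section Measure.
Variable R : realType.
Implicit Types (P : nat -> Prop) (M : nat).

Definition mass M P : R := \sum_(a < M) (`[< P a >])%:R.

Lemma mass_ge0 M P : 0 <= mass M P.
Proof. by apply: sumr_ge0 => i _; rewrite ler0n. Qed.

Lemma mass_le_card M P : mass M P <= M%:R.
Proof.
rewrite /mass -[leRHS]mulr1 mulr_natl -[M in leRHS]card_ord -sumr_const.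
by apply: ler_sum => i _; rewrite lern1 leq_b1.
Qed.

Lemma mass_mono M P P' : (forall a, (a < M)%N -> P a -> P' a) ->
  mass M P <= mass M P'.
Proof.
move=> h; apply: ler_sum => i _; rewrite ler_nat.
have [p|//] := asboolP (P i); rewrite (_ : `[< P' i >]) //.
by apply/asboolP/h.
Qed.

Lemma mass_union M n (E : nat -> nat -> Prop) :
  mass M (fun a => exists2 i, (i < n)%N & E i a) <= \sum_(i < n) mass M (E i).
Proof.
rewrite /mass exchange_big /=; apply: ler_sum => a _.
have [[i ni Ei]|_] := asboolP; last by apply: sumr_ge0 => j _; rewrite ler0n.
rewrite (bigD1 (Ordinal ni)) //= (_ : `[< E i a >]); last exact/asboolP.
by rewrite lerDl; apply: sumr_ge0 => j _; rewrite ler0n.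
Qed.

Lemma mass_union_le M n (E : nat -> nat -> Prop) (c : R) :
  (forall i, (i < n)%N -> mass M (E i) <= c) ->
  mass M (fun a => exists2 i, (i < n)%N & E i a) <= n%:R * c.
Proof.
move=> h; apply: le_trans (mass_union _ _ _) _.
rewrite mulr_natl -[n in leRHS]card_ord -sumr_const.
by apply: ler_sum => i _; apply: h.
Qed.

Lemma mass_or M P P' : mass M (fun a => P a \/ P' a) <= mass M P + mass M P'.
Proof.
rewrite /mass -big_split /=; apply: ler_sum => a _.
rewrite -natrD ler_nat; have [[p|p]|_] := asboolP (_ \/ _) => //.
- by rewrite (_ : `[< P a >]) //; apply/asboolP.
- by rewrite (_ : `[< P' a >]) ?leq_addl //; apply/asboolP.
Qed.

Lemma sum_mulnat (V : nmodType) (f : nat -> V) B M :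
  \sum_(a < B * M) f a = \sum_(w < B) \sum_(a < M) f (w * M + a)%N.
Proof.
elim: B => [|B IH]; first by rewrite mul0n !big_ord0.
rewrite big_ord_recr /= -IH mulSnr.
rewrite -(big_mkord xpredT f) -(big_mkord xpredT f) (@big_cat_nat _ _ _ (B * M)%N) ?leq_addr //=.
by rewrite -{2}[(B * M)%N]add0n big_addn addKn !big_mkord; congr (_ + _);
  apply: eq_bigr => i _; rewrite addnC.
Qed.

Lemma mass_mul B M P :
  mass (B * M) P = \sum_(w < B) mass M (fun a => P (w * M + a)%N).
Proof. exact: (sum_mulnat (fun a => (`[< P a >])%:R)). Qed.

(* Ville's maximal inequality: [expR (lam * S) / G ^+ n] is a martingale along
   the successive blocks of [h] digits. *)
Lemma ville (X : nat -> R) b h Q M0 (lam tau s : R) : (0 < b)%N -> 0 <= lam ->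
  let B := (b ^ h)%N in
  let G := (\sum_(w < B) expR (lam * X w)) / B%:R in
  1 <= G ->
  mass (B ^ Q * M0) (fun a => exists2 n, (n < Q.+1)%N &
    tau <= s + \sum_(q < n) X (wrd b h (B ^ Q * M0) a (h * q))) <=
  (B ^ Q * M0)%:R * (expR (lam * (s - tau)) * G ^+ Q).
Proof.
move=> b0 lam0 B G G1; have B0 : (0 < B)%N by rewrite expn_gt0 b0.
elim: Q s => [|Q IH] s.
  have [st|st] := leP tau s.
    apply: le_trans (mass_le_card _ _) _; rewrite ler_peMr // expr0 mulr1.
    by rewrite -expR0 ler_expR mulr_ge0 // subr_ge0.
  rewrite (_ : mass _ _ = 0); first by rewrite mulr_ge0 // mulr_ge0 ?expR_ge0 // exprn_ge0 // (le_trans ler01).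
  apply: big1 => a _; have [[n]|//] := asboolP.
  by rewrite ltnS leqn0 => /eqP ->; rewrite big_ord0 addr0 leNgt st.
(* Once [s] has reached [tau], both factors on the right are at least 1 and the total mass is a
   sufficient bound. *)
have [st|st] := leP tau s.
  apply: le_trans (mass_le_card _ _) _; rewrite ler_peMr //.
  rewrite -[1]mulr1 ler_pM ?exprn_ege1 //.
  by rewrite -expR0 ler_expR mulr_ge0 // subr_ge0.
rewrite expnS -mulnA mass_mul; set M' := (B ^ Q * M0)%N in IH *.
(* Since [s < tau], the threshold is not reached at [n = 0]; the first block [w] is peeled off and
   the walk restarts from [s + X w]. *)
have step (w : 'I_B) : mass M' (fun a => exists2 n, (n < Q.+2)%N &
    tau <= s + \sum_(q < n) X (wrd b h (B * M') (w * M' + a) (h * q))) <=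
    M'%:R * (expR (lam * (s + X w - tau)) * G ^+ Q).
  apply: le_trans (IH _); apply: mass_mono => a aM [[|n]].
    by rewrite big_ord0 addr0 leNgt st.
  rewrite ltnS => nQ; rewrite big_ord_recl /= muln0 wrd_head // addrA => le.
  exists n => //; apply: le_trans le _; rewrite lerD2l.
  apply: ler_sum => i _; rewrite /bump /= add1n mulnS.
  by rewrite wrd_shift.
apply: le_trans (ler_sum _ (fun w _ => step w)) _.
rewrite -mulr_sumr natrM [B%:R * _]mulrC -mulrA ler_wpM2l //.
rewrite -mulr_suml.
rewrite (eq_bigr (fun w : 'I_B => expR (lam * (s - tau)) * expR (lam * X w))); last first.
  by move=> w _; rewrite -expRD; congr expR; ring.
rewrite -mulr_sumr exprS.
rewrite (_ : \sum_(i < B) _ = B%:R * G); first by rewrite mulrCA !mulrA lexx.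
by rewrite /G mulrC divfK // pnatr_eq0 -lt0n.
Qed.

(** Inverting [1 - x <= expR (- x)] gives [expR x <= (1 - x)^-1], and [(1 + x + 2 * x ^+ 2) * (1 -
    x) = 1 + x ^+ 2 * (1 - 2 * x)] is at least 1 for [x <= 1 / 2]. *)
Lemma expR_le_quad (x : R) : x <= 1 / 2 -> expR x <= 1 + x + 2 * x ^+ 2.
Proof.
move=> x2; have := expR_ge1Dx (- x); rewrite expRN => h.
have p : 0 < 1 - x by lra.
have : expR x <= (1 - x)^-1.
  by rewrite -[expR x]invrK lef_pV2 // posrE ?invr_gt0 ?expR_gt0.
move=> /le_trans; apply; rewrite -[leLHS]mul1r ler_pdivrMr //; nra.
Qed.

Definition Xdev (S : pred nat) (p : R) (w : nat) : R := (S w)%:R - p.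

(** Lower bound: [1 + y <= expR y], and [Xdev] has mean zero. Upper bound: the exponential moment of
    a centred Bernoulli variable is [expR (- (mu * p)) * (1 + p * (expR mu - 1))], estimated by
    [expR_le_quad]. *)
Lemma mgf_bounds (S : pred nat) B (p mu : R) : (0 < B)%N ->
  \sum_(w < B) (S w)%:R = p * B%:R -> `|mu| <= 1 / 2 ->
  1 <= (\sum_(w < B) expR (mu * Xdev S p w)) / B%:R <= expR (2 * p * mu ^+ 2).
Proof.
move=> B0 hS hmu; have B0' : 0 < B%:R :> R by rewrite ltr0n.
have sum1 : \sum_(w < B) (1 : R) = B%:R by rewrite sumr_const card_ord.
have p0 : 0 <= p.
  have : 0 <= p * B%:R by rewrite -hS; apply: sumr_ge0 => w _; rewrite ler0n.
  by rewrite pmulr_lge0.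
apply/andP; split.
  rewrite ler_pdivlMr // mul1r.
  have -> : B%:R = \sum_(w < B) (1 + mu * Xdev S p w).
    rewrite big_split /= sum1 -mulr_sumr big_split /= hS sumr_const card_ord.
    by rewrite -mulr_natr; ring.
  by apply: ler_sum => w _; apply: expR_ge1Dx.
rewrite ler_pdivrMr //.
have -> : \sum_(w < B) expR (mu * Xdev S p w) =
    expR (- (mu * p)) * \sum_(w < B) (1 + (expR mu - 1) * (S w)%:R).
  rewrite mulr_sumr; apply: eq_bigr => w _; rewrite /Xdev mulrBr expRD mulrC.
  congr (_ * _); case: (S w); rewrite ?mulr1 ?mulr0 ?expR0; ring.
rewrite big_split /= sum1 -mulr_sumr hS.
rewrite (_ : B%:R + _ = (1 + p * (expR mu - 1)) * B%:R); last by ring.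
rewrite mulrA ler_wpM2r //.
apply: le_trans (_ : expR (- (mu * p)) * expR (p * (mu + 2 * mu ^+ 2)) <= _).
  rewrite ler_wpM2l ?expR_ge0 //; apply: le_trans (expR_ge1Dx _).
  rewrite lerD2l ler_wpM2l //.
  have /expR_le_quad : mu <= 1 / 2 by apply: le_trans (ler_norm _) _.
  lra.
by rewrite -expRD ler_expR le_eqVlt; apply/orP; left; apply/eqP; ring.
Qed.

(* Comes from [lam = sqrt (t / (pi * Q))], capped at 1/2 in the Poisson range
   [pi * Q < 4 * t]. *)
Definition tau_of (t pi : R) (Q : nat) : R := 3 * Num.sqrt (t * pi * Q%:R) + 6 * t.

Lemma chernoff_choice (t pi p : R) Q : 0 < t -> 0 <= p -> p <= pi ->
  exists lam : R, [/\ 0 <= lam, lam <= 1 / 2 &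
    - (lam * tau_of t pi Q) + Q%:R * (2 * p * lam ^+ 2) <= - t].
Proof.
move=> t0 p0 ppi; set z := Num.sqrt (t * pi * Q%:R).
have pi0 : 0 <= pi by exact: le_trans ppi.
have z2 : z ^+ 2 = t * pi * Q%:R.
  by rewrite sqr_sqrtr //; apply: mulr_ge0 => //; apply: mulr_ge0 => //; exact: ltW.
have z0 : 0 <= z by exact: sqrtr_ge0.
have Q0 : 0 <= Q%:R :> R by [].
(* With [lam = t / z] the linear term is at least [3 * t] and the quadratic term at most [2 * t];
   the case hypothesis says that [lam <= 1 / 2]. *)
have [h|h] := leP (2 * t) z.
  exists (t / z).
  have zp : 0 < z by lra.
  have e : t / z * z = t by rewrite divfK // gt_eqF.
  split; first by rewrite divr_ge0 // ltW.
    by rewrite ler_pdivrMr //; lra.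
  have -> : t / z * tau_of t pi Q = 3 * t + 6 * t ^+ 2 / z.
    rewrite /tau_of -/z mulrDr mulrCA e; ring.
  have : Q%:R * (2 * p * (t / z) ^+ 2) <= 2 * t.
    rewrite expr_div_n z2.
    have hz : 0 < t * pi * Q%:R by rewrite -z2 exprn_gt0.
    rewrite !mulrA ler_pdivrMr //.
    have : p * (Q%:R * t ^+ 2) <= pi * (Q%:R * t ^+ 2).
      by rewrite ler_wpM2r // mulr_ge0 // exprn_ge0 // ltW.
    nra.
  have : 0 <= 6 * t ^+ 2 / z by rewrite divr_ge0 // mulr_ge0 // exprn_ge0 // ltW.
  lra.
(* Now [pi * Q <= 4 * t]: the quadratic term is at most [2 * t], while the summand [6 * t] of
   [tau_of] contributes [3 * t]. *)
exists (1 / 2); split; [lra | lra |].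
have : pi * Q%:R <= 4 * t.
  rewrite -(ler_pM2l t0) mulrA -z2 expr2 (_ : t * (4 * t) = 2 * t * (2 * t)).
    by apply: ler_pM => //; exact: ltW.
  by ring.
have : p * Q%:R <= pi * Q%:R by rewrite ler_wpM2r.
rewrite /tau_of -/z; lra.
Qed.

(** The positions [r + h * q] carry disjoint blocks of digits, which makes the trials independent;
    [sg] is 1 or -1 and selects the tail. *)
Definition exceeds (b h M Q r : nat) (S : pred nat) (p sg tau : R) (a : nat) :=
  exists2 n, (n < Q.+1)%N &
    tau < \sum_(q < n) sg * Xdev S p (wrd b h M a (r + h * q)).

(** The first [r] digits are fixed, and [ville] is applied to the following blocks with the
    parameter from [chernoff_choice]. The threshold uses an upper bound [pi] of [p], so one
    threshold serves all sets of a given word length. *)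
Lemma class_tail b h M r Q (S : pred nat) (p sg t pi : R) :
  (0 < b)%N -> (b ^ (r + h * Q) %| M)%N -> sg ^+ 2 = 1 -> 0 < t ->
  \sum_(w < b ^ h) (S w)%:R = p * (b ^ h)%:R -> p <= pi ->
  mass M (exceeds b h M Q r S p sg (tau_of t pi Q)) <= M%:R * expR (- t).
Proof.
move=> b0 /dvdnP[M0 ->] sg1 t0 hS ppi; set B := (b ^ h)%N.
have B0 : (0 < B)%N by rewrite expn_gt0 b0.
have p0 : 0 <= p.
  have : 0 <= p * B%:R by rewrite -hS; apply: sumr_ge0 => w _; rewrite ler0n.
  by rewrite pmulr_lge0 // ltr0n.
have [lam [l0 l1 hl]] := chernoff_choice Q t0 p0 ppi.
have -> : (M0 * b ^ (r + h * Q) = b ^ r * (B ^ Q * M0))%N.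
  by rewrite expnD expnM -/B; lia.
set M' := (B ^ Q * M0)%N.
rewrite mass_mul natrM -mulrA mulr_natl -[X in _ *+ X]card_ord -sumr_const.
apply: ler_sum => w _.
have nmu : `|lam * sg| <= 1 / 2.
  have /eqP := sg1; rewrite sqrf_eq1 => /orP[] /eqP ->; rewrite ?mulr1 ?mulrN1 ?normrN ger0_norm //.
have /andP[G1 G2] := mgf_bounds B0 hS nmu.
have GE : \sum_(w < B) expR (lam * (sg * Xdev S p w)) =
    \sum_(w < B) expR (lam * sg * Xdev S p w).
  by apply: eq_bigr => i _; rewrite mulrA.
have := @ville (fun w => sg * Xdev S p w) b h Q M0 lam (tau_of t pi Q) 0 b0 l0.
rewrite /= -/B GE => /(_ G1) H.
apply: le_trans (le_trans H _).
  apply: mass_mono => a aM [n nQ le]; exists n => //; rewrite add0r.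
  apply: ltW (lt_le_trans le _); apply: ler_sum => q _.
  by rewrite wrd_shift.
rewrite -/M' ler_wpM2l //.
apply: le_trans (_ : expR (lam * (0 - tau_of t pi Q)) *
   expR (2 * p * (lam * sg) ^+ 2) ^+ Q <= _).
  by rewrite ler_wpM2l ?expR_ge0 // lerXn2r // nnegrE ?expR_ge0 // (le_trans ler01).
rewrite -expRM_natl -expRD ler_expR exprMn sg1.
by apply: le_trans hl; rewrite sub0r mulrN mulr1.
Qed.

End Measure.

(** * Chaining over word lengths *)

Section Chain.
Variable R : realType.

(** Cutting a residue class at the length [N] leaves an initial segment of it, to which a bound on
    all partial sums applies. *)
Lemma prefix_sum (P : pred nat) (f : nat -> R) Q :
  (forall q, P q.+1 -> P q) ->
  exists2 n, (n < Q.+1)%N & \sum_(q < Q) (if P q then f q else 0) = \sum_(q < n) f q.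
Proof.
move=> hP; elim: Q => [|Q [n nQ IH]]; first by exists 0%N; rewrite ?big_ord0.
have [PQ|PQ] := boolP (P Q); last first.
  by exists n; [exact: ltnW | rewrite big_ord_recr /= (negbTE PQ) addr0].
have down d q : P (d + q)%N -> P q by elim: d => // d IHd /hP.
exists Q.+1 => //; apply: eq_bigr => i _; rewrite (down (Q - i)%N) //.
by rewrite subnK // -ltnS.
Qed.

Lemma residue_split (f : nat -> R) h Q N (tau : R) : (N <= Q * h)%N ->
  (forall r n, (r < h)%N -> (n < Q.+1)%N -> \sum_(q < n) f (r + h * q)%N <= tau) ->
  \sum_(j < N) f j <= h%:R * tau.
Proof.
move=> NQ H; rewrite (big_ord_widen _ f NQ) big_mkcond /=.
rewrite (sum_mulnat (fun j => if (j < N)%N then f j else 0)) exchange_big /=.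
rewrite mulr_natl -[X in _ *+ X]card_ord -sumr_const; apply: ler_sum => r _.
have [|n nQ E] := @prefix_sum (fun q => (q * h + r < N)%N) (fun q => f (q * h + r)%N) Q.
  by move=> q; apply: leq_ltn_trans; rewrite mulSn; lia.
rewrite E; apply: le_trans (H r n (ltn_ord r) nQ).
by apply: ler_sum => q _; rewrite addnC mulnC.
Qed.

Lemma level_dev b h M Q N (S : pred nat) (p tau : R) a : (N <= Q * h)%N ->
  (forall r, (r < h)%N -> ~ (exceeds b h M Q r S p 1 tau a \/
                             exceeds b h M Q r S p (-1) tau a)) ->
  `|\sum_(j < N) Xdev S p (wrd b h M a j)| <= h%:R * tau.
Proof.
move=> NQ H; rewrite ler_norml; apply/andP; split.
  rewrite lerNl -sumrN.
  apply: (@residue_split (fun j => - Xdev S p (wrd b h M a j)) _ _ _ _ NQ).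
  move=> r n rh nQ; rewrite leNgt; apply/negP => lt; apply: (H r rh); right.
  by exists n => //; apply: lt_le_trans lt _; apply: ler_sum => q _; rewrite mulN1r.
apply: (@residue_split (fun j => Xdev S p (wrd b h M a j)) _ _ _ _ NQ).
move=> r n rh nQ; rewrite leNgt; apply/negP => lt; apply: (H r rh); left.
by exists n => //; apply: lt_le_trans lt _; apply: ler_sum => q _; rewrite mul1r.
Qed.

Lemma sum_ltn B v : (v <= B)%N -> \sum_(w < B) (w < v)%N%:R = v%:R :> R.
Proof.
move=> vB; rewrite -[in RHS](minn_idPl vB) => {vB}.
elim: B => [|B IH]; first by rewrite big_ord0 minn0.
by rewrite big_ord_recr /= IH -natrD; congr _%:R; lia.
Qed.

(** The words that agree with [v] in all digits but the last, where they are smaller: the sets of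
    the chaining decomposition. *)
Definition last_digit_lt (b v w : nat) := (b * (v %/ b) <= w)%N && (w < v)%N.

Definition last_freq (b h v : nat) : R := (v %% b)%:R / (b ^ h)%:R.

Lemma last_digit_ltE b v w : (0 < b)%N ->
  (w < v)%N%:R = (w %/ b < v %/ b)%N%:R + (last_digit_lt b v w)%:R :> R.
Proof.
move=> b0; rewrite ltn_divLR // mulnC /last_digit_lt -natrD; congr _%:R.
have le : (b * (v %/ b) <= v)%N by rewrite mulnC leq_trunc_div.
by case: (ltnP w (b * (v %/ b))) => //= lt; rewrite (leq_trans lt le).
Qed.

Lemma sum_last_digit_lt b h v : (0 < b)%N -> (v <= b ^ h)%N ->
  \sum_(w < b ^ h) (last_digit_lt b v w)%:R = last_freq b h v * (b ^ h)%:R.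
Proof.
move=> b0 vB; rewrite /last_freq divfK ?pnatr_eq0 -?lt0n ?expn_gt0 ?b0 //.
have := @sum_ltn (b ^ h) v vB.
under eq_bigr => w _ do rewrite (@last_digit_ltE b) //.
rewrite big_split /=.
under eq_bigr => w _ do rewrite ltn_divLR //.
have le : (v %/ b * b <= v)%N by exact: leq_trunc_div.
rewrite sum_ltn; last exact: leq_trans vB.
move/(canRL (addKr _)) => ->; rewrite {2}(divn_eq v b) natrD; ring.
Qed.

(** Fewer than [b] words out of [b ^ h.+1] have frequency at most [b ^ - h], and
    [1 / 2 <= 25 / 49]. *)
Lemma last_freq_le b h v : (1 < b)%N ->
  last_freq b h.+1 v <= (5 / 7) ^+ (2 * h).
Proof.
move=> b1; have b0 : (0 < b)%N by lia.
apply: le_trans (_ : ((b ^ h)%:R)^-1 <= _).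
  rewrite /last_freq ler_pdivrMr ?ltr0n ?expn_gt0 ?b0 // expnS natrM.
  rewrite mulrCA mulVf ?mulr1 ?pnatr_eq0 -?lt0n ?expn_gt0 ?b0 //.
  by rewrite ler_nat ltnW // ltn_pmod.
have c0 : 0 <= (5 / 7) ^+ 2 :> R by rewrite exprn_ge0 // divr_ge0.
rewrite natrX -exprVn exprM lerXn2r ?nnegrE ?invr_ge0 //.
apply: le_trans (_ : 2%:R^-1 <= _); last lra.
by rewrite lef_pV2 ?posrE ?ltr0n // ler_nat.
Qed.

Definition dev (b h M a N v : nat) : R :=
  \sum_(j < N) ((wrd b h M a j < v)%N%:R - v%:R / (b ^ h)%:R).

(** A word of length [h.+1] is below [v] when its prefix is below [v %/ b], or when the prefix is
    equal and the last digit is smaller. *)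
Lemma dev_step b h M a N v : (0 < b)%N ->
  dev b h.+1 M a N v = dev b h M a N (v %/ b) +
    \sum_(j < N) Xdev (last_digit_lt b v) (last_freq b h.+1 v) (wrd b h.+1 M a j).
Proof.
move=> b0; rewrite /dev -big_split /=; apply: eq_bigr => j _.
rewrite (@last_digit_ltE b) // wrd_div // /Xdev /last_freq.
have : (b ^ h)%:R != 0 :> R by rewrite pnatr_eq0 -lt0n expn_gt0 b0.
have : b%:R != 0 :> R by rewrite pnatr_eq0 -lt0n.
have -> : v%:R = (v %/ b)%:R * b%:R + (v %% b)%:R :> R.
  by rewrite -natrM -natrD -divn_eq.
by rewrite expnS natrM => B0 Bh; field; rewrite B0 Bh.
Qed.

Lemma dev0 b M a N v : (0 < M)%N -> (v <= 1)%N -> dev b 0 M a N v = 0.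
Proof.
move=> M0 v1; apply: big1 => j _.
rewrite /wrd !expn0 muln1 divn_small ?ltn_pmod // divr1.
by case: v v1 => [|[|]] // _; rewrite ?subrr.
Qed.

(** Rounded up, so that for positive [h] the trials of the classes modulo [h] cover all positions
    below [2 ^ k.+1]. *)
Definition Qn (k h : nat) := (2 ^ k.+1 %/ h).+1.

(* Here [7 * h.+1 * l] beats the number of choices of a word of length [h.+1] in
   a base [b <= l], and [(5 / 7) ^+ 2] is a square that is at least 1/2. *)
Definition tau (l k h : nat) : R :=
  tau_of (7 * h.+1 * l)%:R ((5 / 7) ^+ (2 * h)) (Qn k h.+1).

Definition unlucky (b l k M a : nat) : Prop :=
  exists2 h, (h < 2 ^ l)%N & exists2 v, (v < (b ^ h.+1).+1)%N &
  exists2 r, (r < h.+1)%N &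
    exceeds b h.+1 M (Qn k h.+1) r (last_digit_lt b v) (last_freq b h.+1 v) 1
      (tau l k h) a \/
    exceeds b h.+1 M (Qn k h.+1) r (last_digit_lt b v) (last_freq b h.+1 v) (-1)
      (tau l k h) a.

(** [dev_step] is iterated down to the empty word, whose deviation vanishes. The step to length
    [h.+1] splits into [h.+1] residue classes, each bounded by [tau]. *)
Lemma dev_sum_le b l k M a N H v : (1 < b)%N -> (0 < M)%N ->
  (N < 2 ^ k.+1)%N -> ~ unlucky b l k M a -> (H <= 2 ^ l)%N -> (v <= b ^ H)%N ->
  `|dev b H M a N v| <= \sum_(h < H) h.+1%:R * tau l k h.
Proof.
move=> b1 M0 Nk nu; have b0 : (0 < b)%N by lia.
elim: H v => [|H IH] v Hl vB; first by rewrite dev0 // normr0 big_ord0.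
rewrite dev_step // big_ord_recr /=; apply: le_trans (ler_normD _ _) _.
apply: lerD.
  apply: IH; first exact: ltnW.
  by rewrite -ltnS ltn_divLR // mulSn -expnSr; lia.
apply: (@level_dev b H.+1 M (Qn k H.+1)).
  have := ltn_ceil (2 ^ k.+1) (ltn0Sn H); rewrite /Qn; lia.
move=> r rH h; apply: nu; exists H => //; exists v; first by rewrite ltnS.
by exists r.
Qed.

Lemma expRN_nat n : expR (- n%:R) <= 2^-1 ^+ n :> R.
Proof.
rewrite -[n%:R]mulr1 -mulrN expRM_natl lerXn2r ?nnegrE ?expR_ge0 ?invr_ge0 //.
rewrite expRN lef_pV2 ?posrE ?expR_gt0 //.
by have := expR_ge1Dx (1 : R); rewrite -[1 + 1]/(2%:R).
Qed.

Lemma mass_unlucky b l k M : (1 < b)%N -> (b <= l)%N ->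
  (b ^ (2 ^ k.+1 + 2 * 2 ^ l) %| M)%N ->
  mass R M (unlucky b l k M) <= M%:R * (4 * 2^-1 ^+ (4 * l)).
Proof.
move=> b1 bl bM; have b0 : (0 < b)%N by lia.
apply: le_trans (mass_union _ _ _ _) _.
have each (h : 'I_(2 ^ l)) : mass R M (fun a => exists2 v, (v < (b ^ h.+1).+1)%N &
  exists2 r, (r < h.+1)%N &
    exceeds b h.+1 M (Qn k h.+1) r (last_digit_lt b v) (last_freq b h.+1 v) 1
      (tau l k h) a \/
    exceeds b h.+1 M (Qn k h.+1) r (last_digit_lt b v) (last_freq b h.+1 v) (-1)
      (tau l k h) a) <= M%:R * (4 * 2^-1 ^+ (4 * l) * 2^-1 ^+ h.+1).
  have t0 : 0 < (7 * h.+1 * l)%:R :> R by rewrite ltr0n; nia.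
  apply: le_trans (_ : _ <= (b ^ h.+1).+1%:R * (h.+1%:R *
      (M%:R * expR (- (7 * h.+1 * l)%:R) + M%:R * expR (- (7 * h.+1 * l)%:R)))) _.
    apply: mass_union_le => v vB; apply: mass_union_le => r rh.
    (* The rounding in [Qn] and the offset [r] cost at most one word each beyond [2 ^ k.+1]
       digits. *)
    have dM : (b ^ (r + h.+1 * Qn k h.+1) %| M)%N.
      apply: dvdn_trans bM; apply: dvdn_exp2l; rewrite /Qn mulnS.
      have := leq_trunc_div (2 ^ k.+1) h.+1; have := ltn_ord h.
      rewrite mulnC; lia.
    apply: le_trans (mass_or _ _ _ _) _; apply: lerD.
      apply: class_tail => //; first by rewrite expr1n.
        by apply: sum_last_digit_lt.
      exact: last_freq_le.
    apply: class_tail => //; first by rewrite sqrrN expr1n.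
      by apply: sum_last_digit_lt.
    exact: last_freq_le.
  set e := expR _.
  have he : e <= 2^-1 ^+ (7 * h.+1 * l) by exact: expRN_nat.
  have e0 : 0 <= e by exact: expR_ge0.
  (* This bounds the number of pairs [(v, r)]. Of the exponent [7 * h.+1 * l] at least
     [4 * l + h.+1] is left, and the part [h.+1] gives a geometric series in [h]. *)
  have hb : ((b ^ h.+1).+1 * h.+1 <= 2 * (2 ^ (2 * (h.+1 * l))))%N.
    have h1 : (b ^ h.+1 <= 2 ^ (h.+1 * l))%N.
      rewrite [(h.+1 * l)%N]mulnC expnM leq_exp2r //.
      by apply: leq_trans bl _; apply: ltnW; apply: ltn_expl.
    have h2 : (h.+1 <= 2 ^ (h.+1 * l))%N.
      apply: leq_trans (ltnW (ltn_expl h.+1 (ltnSn 1))) _.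
      by rewrite leq_exp2l //; nia.
    have h3 : (0 < b ^ h.+1)%N by rewrite expn_gt0 b0.
    rewrite [(2 * (h.+1 * l))%N]mul2n -addnn expnD mulnA; apply: leq_mul => //; lia.
  have -> : (b ^ h.+1).+1%:R * (h.+1%:R * (M%:R * e + M%:R * e)) =
     M%:R * (2 * ((b ^ h.+1).+1 * h.+1)%:R * e) by rewrite natrM; ring.
  rewrite ler_wpM2l //.
  have -> : 4 * 2^-1 ^+ (4 * l) * 2^-1 ^+ h.+1 =
     2 * (2 * 2 ^ (2 * (h.+1 * l)))%:R * 2^-1 ^+ (2 * (h.+1 * l) + 4 * l + h.+1) :> R.
    set n := (2 * (h.+1 * l))%N.
    have : 2 ^+ n * 2^-1 ^+ n = 1 :> R.
      by rewrite -exprMn divff ?expr1n // pnatr_eq0.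
    rewrite natrM natrX (exprD _ (n + 4 * l)) (exprD _ n); move: (2 ^+ n) (2^-1 ^+ n) (2^-1 ^+ (4 * l)) (2^-1 ^+ h.+1).
    move=> u v x y uv; transitivity (4 * (u * v) * x * y); last by ring.
    by rewrite uv mulr1.
  apply: ler_pM => //.
    by rewrite ler_wpM2l // ler_nat.
  apply: le_trans he _; apply: ler_wiXn2l; [lra|lra|nia].
apply: le_trans (ler_sum _ (fun h _ => each h)) _.
rewrite -mulr_sumr -mulr_sumr mulrA -[leRHS]mulr1 -!mulrA.
do 3 (rewrite ler_wpM2l ?exprn_ge0 ?invr_ge0 //).
have geo n : \sum_(h < n) 2^-1 ^+ h.+1 = 1 - 2^-1 ^+ n :> R.
  elim: n => [|n IH]; first by rewrite big_ord0 expr0 subrr.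
  by rewrite big_ord_recr /= IH exprS; lra.
by rewrite geo gerBl exprn_ge0 // invr_ge0.
Qed.

End Chain.

(** * The integer test for failure and the density of bad points *)

Definition cnt (b h M a N v : nat) : nat := \sum_(j < N) (wrd b h M a j < v)%N.

(** The comparison of [180 * sqrt (l * N)] with the deviation, squared and cleared of the
    denominator [B], so that integer arithmetic decides it. *)
Definition fail (b l N v M a : nat) : bool :=
  let B : int := (b ^ (2 ^ l))%:Z in
  180%:Z * 180%:Z * N%:Z * l%:Z * (B * B) <
    ((cnt b (2 ^ l) M a N v)%:Z * B - N%:Z * v%:Z) ^+ 2.

Definition bad (b l M a : nat) : Prop :=
  exists N v, [/\ (2 ^ (2 ^ l) <= N < 2 ^ (2 ^ l.+1))%N, (v <= b ^ (2 ^ l))%N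
    & fail b l N v M a].

Section Bad.
Variable R : realType.

Lemma dev_cnt b h M a N v :
  dev R b h M a N v = (cnt b h M a N v)%:R - N%:R * v%:R / (b ^ h)%:R.
Proof.
rewrite /dev big_split /= sumr_const card_ord -[X in _ + X]mulr_natl mulrN mulrA.
by rewrite /cnt natr_sum.
Qed.

Lemma failE b l N v M a : (0 < b)%N ->
  fail b l N v M a =
  (180 * Num.sqrt (l * N)%:R < `|dev R b (2 ^ l) M a N v|).
Proof.
move=> b0; rewrite /fail; set B := (b ^ _)%N.
have B0 : 0 < B%:R :> R by rewrite ltr0n expn_gt0 b0.
rewrite -(ltr_int R) -[RHS]ltr_sqr ?nnegrE ?mulr_ge0 ?sqrtr_ge0 //.
rewrite exprMn sqr_sqrtr // -normrX ger0_norm ?sqr_ge0 // dev_cnt -/B.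
rewrite -[in RHS](ltr_pM2r (exprn_gt0 2 B0)) -exprMn mulrBl.
rewrite (divfK (lt0r_neq0 B0)).
rewrite !expr2 !(intrM, intrB) -!pmulrn natrM.
by congr (_ < _); ring.
Qed.

(** The series of [h.+1 * x ^ h] sums to [(1 - x) ^- 2], which is [49 / 4] at [x = 5 / 7]. *)
Lemma sum_arith_geom n :
  \sum_(h < n) h.+1%:R * (5 / 7) ^+ h <= 49 / 4 :> R.
Proof.
have E : (4 / 49) * \sum_(h < n) h.+1%:R * (5 / 7) ^+ h =
    1 - (5 / 7) ^+ n * (1 + 2 / 7 * n%:R) :> R.
  elim: n => [|n IH]; first by rewrite big_ord0 expr0; ring.
  by rewrite big_ord_recr /= mulrDr IH exprS -natr1; lra.
have : 0 <= (5 / 7) ^+ n * (1 + 2 / 7 * n%:R) :> R.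
  by rewrite mulr_ge0 ?exprn_ge0 ?addr_ge0 ?mulr_ge0 //; lra.
lra.
Qed.

(** Level 6 is the first at which this holds, hence the start of the levels; it makes the linear
    terms of [tau] negligible in [sum_tau_le]. *)
Lemma exp_gt_linear l : (6 <= l)%N -> (9 + 7 * l <= 2 ^ l)%N.
Proof.
elim: l => // l IH; rewrite leq_eqVlt => /predU1P[<- //|].
by rewrite ltnS => /IH; rewrite expnS; lia.
Qed.

Lemma sum_tau_le l k N : (6 <= l)%N -> (2 ^ l <= k)%N -> (2 ^ k <= N)%N ->
  \sum_(h < 2 ^ l) h.+1%:R * tau R l k h <= 180 * Num.sqrt (l * N)%:R.
Proof.
move=> l6 lk kN; set H := (2 ^ l)%N.
have Hk : (H <= 2 ^ k)%N.
  by apply: leq_trans (ltnW (ltn_expl _ (ltnSn 1))) _; rewrite leq_exp2l.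
pose s : R := Num.sqrt (l * N)%:R.
have s0 : 0 <= s by exact: sqrtr_ge0.
(* The factor [23 / 5] exceeds the square root of [21 = 7 * 3], where 3 comes from
   [h.+1 * Qn k h.+1 <= 3 * N]; [42 = 6 * 7] belongs to the linear term of [tau_of]. In the end
   [3 * (23 / 5) * (49 / 4) + 2 < 180]. *)
have each (h : 'I_H) : h.+1%:R * tau R l k h <=
    (3 * (23 / 5) * s) * (h.+1%:R * (5 / 7) ^+ h) + 42 * (H * H * l)%:R.
  have x0 : 0 <= 5 / 7 :> R by lra.
  have hQ : (7 * h.+1 * l * Qn k h.+1 <= 21 * (l * N))%N.
    have : (h.+1 * Qn k h.+1 <= 3 * N)%N.
      rewrite /Qn mulnS; have := leq_trunc_div (2 ^ k.+1) h.+1.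
      by have := ltn_ord h; rewrite expnS mulnC; lia.
    by move=> e; have := leq_mul (leqnn (7 * l)) e; nia.
  have hs (x : R) : 0 <= x ->
      Num.sqrt ((7 * h.+1 * l)%:R * x ^+ (2 * h) * (Qn k h.+1)%:R) <=
      23 / 5 * s * x ^+ h.
    move=> x1; have r0 : 0 <= 23 / 5 * s * x ^+ h by rewrite !mulr_ge0 ?exprn_ge0.
    rewrite -[leRHS]ger0_norm // -sqrtr_sqr ler_wsqrtr // exprMn exprMn sqr_sqrtr //.
    rewrite [in leLHS]mulrAC -natrM exprM exprAC ler_wpM2r ?exprn_ge0 //.
    apply: le_trans (_ : (21 * (l * N))%:R <= _); first by rewrite ler_nat.
    rewrite natrM ler_wpM2r //; lra.
  have {}hs := hs _ x0.
  rewrite /tau /tau_of.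
  have h1 : 6 * (7 * h.+1 * l)%:R * h.+1%:R <= 42 * (H * H * l)%:R :> R.
    rewrite -!natrM ler_nat; have := ltn_ord h => hH.
    have : (h.+1 * h.+1 <= H * H)%N by apply: leq_mul.
    nia.
  have := ler_wpM2l (ler0n R h.+1) hs.
  move: (Num.sqrt _) ((5 / 7) ^+ h) h1 => u v h1; nra.
apply: le_trans (ler_sum _ (fun h _ => each h)) _.
rewrite big_split /= -mulr_sumr sumr_const card_ord -[X in _ + X]mulr_natl.
(* The linear terms total at most [42 * H ^ 3 * l], with square [4 * l * (441 * H ^ 6 * l)]; since
   [441 < 2 ^ 9] and [l <= H = 2 ^ l], the bracket is at most [2 ^ (9 + 7 * l) <= N]. *)
have lo : H%:R * (42 * (H * H * l)%:R) <= 2 * s.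
  have r0 : 0 <= 2 * s by rewrite mulr_ge0.
  rewrite -[leRHS]ger0_norm // -sqrtr_sqr -[leLHS]ger0_norm //.
  rewrite -sqrtr_sqr ler_wsqrtr // [in leRHS]exprMn sqr_sqrtr // -!natrM -!natrX -natrM ler_nat.
  have lH : (l <= H)%N by apply: ltnW; apply: ltn_expl.
  have HN : (441 * (H ^ 6 * l) <= N)%N.
    apply: leq_trans kN; apply: (@leq_trans (2 ^ (9 + 7 * l))).
      rewrite expnD; apply: leq_mul => //.
      rewrite mulnC expnM -/H.
      have -> : ((2 ^ 7) ^ l = H ^ 6 * H)%N by rewrite -expnSr -!expnM mulnC.
      by rewrite mulnC leq_mul2l lH orbT.
    by rewrite leq_exp2l //; apply: leq_trans lk; apply: exp_gt_linear.
  have -> : ((H * (42 * (H * H * l))) ^ 2 = 4 * l * (441 * (H ^ 6 * l)))%N.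
    by rewrite !expnS !expn0; ring.
  by rewrite -mulnA (_ : (2 ^ 2)%N = 4%N) // !leq_mul2l HN !orbT.
have := ler_wpM2l (_ : 0 <= 3 * (23 / 5) * s) (sum_arith_geom H).
have -> : 0 <= 3 * (23 / 5) * s by rewrite !mulr_ge0.
move=> /(_ isT); rewrite -/s; lra.
Qed.

(** If [2 ^ k <= N < 2 ^ k.+1], then [2 ^ l <= k < 2 ^ l.+1], and the maximal bound for this dyadic
    block covers every length in it. *)
Lemma bad_unlucky b l M a : (6 <= l)%N -> (1 < b)%N -> (0 < M)%N -> bad b l M a ->
  exists2 k, (k < 2 ^ l)%N & unlucky R b l (2 ^ l + k) M a.
Proof.
move=> l6 b1 M0 [N [v [/andP[N1 N2] vB fl]]]; apply: contrapT => nu.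
have N0 : (0 < N)%N by apply: leq_trans N1; rewrite expn_gt0.
have /andP[k1 k2] := @trunc_log_bounds 2 N (ltnSn 1) N0.
set k := trunc_log 2 N in k1 k2.
have lk : (2 ^ l <= k)%N 
  by rewrite -ltnS -(ltn_exp2l _ _ (ltnSn 1)); apply: leq_ltn_trans N1 k2.
have kl : (k < 2 ^ l.+1)%N by rewrite -(@ltn_exp2l 2) //; apply: leq_ltn_trans N2.
have nuk : ~ unlucky R b l k M a.
  move=> u; apply: nu; exists (k - 2 ^ l)%N; last by rewrite subnKC.
  by rewrite expnS in kl; lia.
move: fl; rewrite failE ?(ltnW b1) // ltNge => /negP; apply.
apply: le_trans (sum_tau_le l6 lk k1).
exact: dev_sum_le k2 nuk _ vB.
Qed.

(** The exponent of [mass_unlucky] for the largest [k] of level [l]; it also covers every digit read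
    by the tests of the level. *)
Definition digits_needed (l : nat) := (2 ^ (2 ^ l.+1) + 2 * 2 ^ l)%N.

Lemma mass_bad b l M : (6 <= l)%N -> (1 < b)%N -> (b <= l)%N -> (0 < M)%N ->
  (b ^ digits_needed l %| M)%N ->
  mass R M (bad b l M) <= (2 ^ l)%:R * (M%:R * (4 * 2^-1 ^+ (4 * l))).
Proof.
move=> l6 b1 bl M0 bM.
apply: le_trans (mass_mono _ (fun a _ => @bad_unlucky b l M a l6 b1 M0)) _.
apply: mass_union_le => k kl; apply: mass_unlucky => //.
apply: dvdn_trans bM; apply: dvdn_exp2l; rewrite leq_add2r leq_exp2l //.
by rewrite expnS; lia.
Qed.

(** Since [4 * l.+1 <= 2 ^ l], the union over bases and dyadic blocks costs at most [2 ^ (2 * l)]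
    against the gain [2 ^- (4 * l)]. *)
Lemma mass_bad_level l M : (6 <= l)%N -> (0 < M)%N ->
  (forall b, (1 < b)%N -> (b <= l)%N -> (b ^ digits_needed l %| M)%N) ->
  mass R M (fun a => exists2 b, (b < l.+1)%N & (1 < b)%N /\ bad b l M a) <=
  M%:R * 2^-1 ^+ (2 * l).
Proof.
move=> l6 M0 bM.
apply: le_trans (_ : _ <= l.+1%:R * ((2 ^ l)%:R * (M%:R * (4 * 2^-1 ^+ (4 * l))))) _.
  apply: mass_union_le => b; rewrite ltnS => bl.
  have [b1|b1] := boolP (1 < b)%N; last first.
    rewrite (_ : mass _ _ _ = 0) ?mulr_ge0 ?exprn_ge0 ?invr_ge0 //.
    by apply: big1 => a _; have [[]|//] := asboolP.
  by apply: le_trans (mass_bad l6 b1 bl M0 (bM b b1 bl)); apply: mass_mono => a _ [].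
have hl : (l.+1 * 4 <= 2 ^ l)%N by have := exp_gt_linear l6; lia.
have -> : l.+1%:R * ((2 ^ l)%:R * (M%:R * (4 * 2^-1 ^+ (4 * l)))) =
   M%:R * ((l.+1 * 4 * 2 ^ l)%:R * 2^-1 ^+ (4 * l)) :> R by rewrite !natrM; ring.
rewrite ler_wpM2l //.
apply: le_trans (_ : (2 ^ l * 2 ^ l)%:R * 2^-1 ^+ (4 * l) <= _).
  by rewrite ler_wpM2r ?exprn_ge0 ?invr_ge0 // ler_nat leq_mul2r hl orbT.
rewrite -expnD natrX (_ : (4 * l = (l + l) + 2 * l)%N); last lia.
by rewrite (exprD _ (l + l) (2 * l)) mulrA -exprMn divff ?pnatr_eq0 // expr1n mul1r.
Qed.

End Bad.

(** * Choosing the digits *)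

(* Level [i + 6], base [j + 2], length [2 ^ (2 ^ (i + 6)) + k], end point [v]:
   the shape is that of the loops of the program. *)
Definition badsum (n M a : nat) : nat :=
  \sum_(0 <= i < n.+1) \sum_(0 <= j < i + 5)
    \sum_(0 <= k < 2 ^ (2 ^ (i + 6)) * 2 ^ (2 ^ (i + 6)) - 2 ^ (2 ^ (i + 6)))
      \sum_(0 <= v < ((j + 2) ^ (2 ^ (i + 6))).+1)
        fail (j + 2) (i + 6) (2 ^ (2 ^ (i + 6)) + k) v M a.

Definition isbad (n M a : nat) : bool := (0 < badsum n M a)%N.

Definition len (m : nat) := (2 ^ (2 ^ m.+2))%N.
(* Locked: unfolding closed instances of [grid] is hopeless. *)
Fact grid_key : unit. Proof. exact: tt. Qed.
Definition grid := locked_with grid_key (fun n => ((n + 6)`! ^ len (n + 6))%N).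
Lemma gridE n : grid n = ((n + 6)`! ^ len (n + 6))%N.
Proof. by rewrite /grid unlock. Qed.
(** The number of grid points in a dyadic interval of length [2 ^- n.+1]. *)
Definition mesh (n : nat) := (grid n %/ 2 ^ n.+1)%N.

Definition badcount (n c : nat) : nat :=
  \sum_(i < mesh n) isbad n (grid n) (c * mesh n + i).

(** The interval numbered [A] has the halves [2 * A] and [2 * A + 1]; a tie goes to the left
    half. *)
Definition digit (n A : nat) : bool :=
  (badcount n (2 * A).+1 < badcount n (2 * A))%N.

Fixpoint numer (n : nat) : nat :=
  if n is n'.+1 then (2 * numer n' + digit n' (numer n'))%N else 0%N.

Definition badlevel (l M a : nat) : Prop :=
  exists2 b, (b < l.+1)%N & (1 < b)%N /\ bad b l M a.

Lemma sum_gt0 n (F : nat -> nat) :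
  (0 < \sum_(0 <= i < n) F i)%N <-> exists2 i, (i < n)%N & (0 < F i)%N.
Proof.
rewrite big_mkord lt0n sum_nat_eq0; split => [/forallPn[i Fi]|[i ni Fi]].
  by exists i => //; rewrite lt0n.
by apply/forallPn; exists (Ordinal ni); rewrite -lt0n.
Qed.

Lemma isbadP n M a :
  isbad n M a <-> exists2 i, (i < n.+1)%N & badlevel (i + 6) M a.
Proof.
have sq i : (2 ^ (2 ^ i.+1) = 2 ^ (2 ^ i) * 2 ^ (2 ^ i))%N.
  by rewrite -expnD addnn -mul2n -expnS.
rewrite /isbad /badsum; split.
  move=> /sum_gt0[i ni /sum_gt0[j ji /sum_gt0[k kP /sum_gt0[v vB fl]]]].
  exists i => //; exists (j + 2)%N; first lia.
  split; first lia.
  exists (2 ^ (2 ^ (i + 6)) + k)%N, v; split => //; last by move: fl; case: fail.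
  by rewrite leq_addr sq; lia.
move=> [i ni [b bl [b1 [N [v [/andP[N1 N2] vB fl]]]]]].
apply/sum_gt0; exists i => //; apply/sum_gt0; exists (b - 2)%N; first lia.
apply/sum_gt0; exists (N - 2 ^ (2 ^ (i + 6)))%N.
  by rewrite sq in N2; lia.
by apply/sum_gt0; exists v; rewrite subnK // subnKC // fl.
Qed.

Lemma wrdE b h j M a : (0 < b)%N -> (0 < M)%N ->
  wrd b h (b ^ j * (b ^ h * M)) a j = ((a %% (b ^ h * M)) %/ M)%N.
Proof.
move=> b0 M0; rewrite {1}(divn_eq a (b ^ h * M)).
have := @wrd_shift b h j (b ^ h * M) (a %/ (b ^ h * M)) (a %% (b ^ h * M)) 0 b0.
rewrite addn0 => ->; rewrite /wrd expn0 mul1n modn_mod.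
by rewrite mulnC divnMl // expn_gt0 b0.
Qed.

(** As [b ^ (j + h)] divides [M], an arc of length [b ^- (j + h)] is a union of cells of the grid,
    so all refined points in one cell have the same word. *)
Lemma wrd_refine b h j M C a e : (0 < b)%N -> (0 < M)%N -> (e < C)%N ->
  (b ^ (j + h) %| M)%N -> wrd b h (M * C) (a * C + e) j = wrd b h M a j.
Proof.
move=> b0 M0 eC /dvdnP[M2 EM].
have C0 : (0 < C)%N by lia.
have M20 : (0 < M2)%N by case: M2 EM M0 => // ->.
have -> : M = (b ^ j * (b ^ h * M2))%N by rewrite EM expnD; lia.
rewrite -!mulnA wrdE // ?muln_gt0 ?M20 // wrdE //.
rewrite mulnA; set M1 := (b ^ h * M2)%N.
have -> : (a * C + e = (a %/ M1) * (M1 * C) + ((a %% M1) * C + e))%N.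
  by rewrite {1}(divn_eq a M1); ring.
rewrite modnMDl.
have M10 : (0 < M1)%N by rewrite muln_gt0 expn_gt0 b0.
rewrite modn_small.
  by rewrite (mulnC M2) divnMA divnMDl // (divn_small eC) addn0.
have := ltn_pmod a M10; nia.
Qed.

Lemma fail_refine b l N v M C a e : (0 < b)%N -> (0 < M)%N -> (e < C)%N ->
  (N < 2 ^ (2 ^ l.+1))%N -> (b ^ digits_needed l %| M)%N ->
  fail b l N v (M * C) (a * C + e) = fail b l N v M a.
Proof.
move=> b0 M0 eC Nl bM; rewrite /fail /cnt.
under eq_bigr => j _.
  rewrite wrd_refine //; last first.
    apply: dvdn_trans bM; apply: dvdn_exp2l; rewrite /digits_needed.
    by have := ltn_ord j; lia.
  over.
by [].
Qed.

Lemma bad_refine b l M C a e : (0 < b)%N -> (0 < M)%N -> (e < C)%N ->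
  (b ^ digits_needed l %| M)%N ->
  bad b l (M * C) (a * C + e) -> bad b l M a.
Proof.
move=> b0 M0 eC bM [N [v [/andP[N1 N2] vB fl]]]; exists N, v.
by split; rewrite ?N1 // -(fail_refine v a b0 M0 eC N2 bM).
Qed.

Lemma digits_needed_le l m : (l <= m)%N -> (digits_needed l <= len m)%N.
Proof.
move=> lm; rewrite /digits_needed /len -expnS.
have h1 : (2 ^ l.+1 <= 2 ^ (2 ^ l.+1))%N by rewrite leq_exp2l // ltnW // ltn_expl.
have h2 : (2 ^ (2 ^ l.+1) <= 2 ^ (2 ^ m.+1))%N by rewrite !leq_exp2l.
have h3 : (2 ^ (2 ^ m.+1) * 2 <= 2 ^ (2 ^ m.+2))%N.
  by rewrite -expnSr leq_exp2l // [in leqRHS]expnS; have := expn_gt0 2 m.+1; lia.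
lia.
Qed.

Lemma grid_gt0 n : (0 < grid n)%N.
Proof. by rewrite gridE expn_gt0 fact_gt0. Qed.

(** Every base [b <= n + 6] divides the factorial, and [len (n + 6)] is at least the number of
    digits needed at each level up to [n + 6]. *)
Lemma dvdn_grid b l n : (1 < b)%N -> (b <= l)%N -> (l <= n + 6)%N ->
  (b ^ digits_needed l %| grid n)%N.
Proof.
move=> b1 bl ln; rewrite gridE; apply: dvdn_trans (_ : (b ^ len (n + 6) %| _)%N).
  exact/dvdn_exp2l/digits_needed_le.
by apply: dvdn_exp2r; apply: dvdn_fact; lia.
Qed.

Lemma leq_len m : (m <= len m)%N.
Proof.
apply: leq_trans (ltnW (ltn_expl m (ltnSn 1))) _; rewrite leq_exp2l //.
by apply: leq_trans (ltnW (ltn_expl m (ltnSn 1))) _; rewrite leq_exp2l //; lia.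
Qed.

Lemma mesh_mul n : (mesh n * 2 ^ n.+1)%N = grid n.
Proof.
apply: divnK; rewrite gridE; apply: dvdn_trans (_ : (2 ^ len (n + 6) %| _)%N).
  by apply: dvdn_exp2l; apply: leq_trans (leq_len _); lia.
by apply: dvdn_exp2r; apply: dvdn_fact; lia.
Qed.

Lemma mesh_gt0 n : (0 < mesh n)%N.
Proof. by have := grid_gt0 n; rewrite -mesh_mul muln_gt0 => /andP[]. Qed.

Lemma grid_dvdS n : (grid n %| grid n.+1)%N.
Proof.
rewrite !gridE; apply: dvdn_trans (_ : ((n + 6)`! ^ len (n.+1 + 6) %| _)%N).
  by apply: dvdn_exp2l; rewrite /len !leq_exp2l.
by apply: dvdn_exp2r; rewrite addSn factS dvdn_mull.
Qed.

(** * The density invariant of the bisection *)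

Section Invariant.
Variable R : realType.

Lemma mass_badcount n c : (badcount n c)%:R =
  mass R (mesh n) (fun i => isbad n (grid n) (c * mesh n + i)).
Proof. by rewrite natr_sum; apply: eq_bigr => i _; rewrite asboolb. Qed.

(* At stage [n] the current interval is [2 * mesh n] grid points long. *)
Definition invariant n : Prop :=
  mass R (2 * mesh n) (fun i => isbad n (grid n) (numer n * (2 * mesh n) + i)) <=
  (2 * mesh n)%:R * (1 - 2^-1 ^+ n.+1).

(** The smaller of the counts of the two halves is at most their average. *)
Lemma invariant_half n : invariant n ->
  mass R (mesh n) (fun i => isbad n (grid n) (numer n.+1 * mesh n + i)) <=
  (mesh n)%:R * (1 - 2^-1 ^+ n.+1).
Proof.
rewrite /invariant mass_mul big_ord_recl big_ord1 /= /bump /= addn0 mul0n mul1n.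
set A := numer n; set K := mesh n.
have -> : mass R K (fun a => isbad n (grid n) (A * (2 * K) + (0 + a))) =
    (badcount n (2 * A))%:R.
  rewrite mass_badcount -/K; apply: eq_bigr => i _.
  by rewrite add0n mulnA (mulnC A).
have -> : mass R K (fun a => isbad n (grid n) (A * (2 * K) + (K + a))) =
    (badcount n (2 * A).+1)%:R.
  rewrite mass_badcount -/K; apply: eq_bigr => i _.
  by congr (`[< is_true (isbad n (grid n) _) >])%:R; lia.
have -> : mass R K (fun i => isbad n (grid n) ((2 * A + digit n A) * K + i)) =
    (badcount n (2 * A + digit n A))%:R by rewrite mass_badcount.
rewrite natrM -mulrA => h; rewrite /digit.
case: (ltnP (badcount n (2 * A).+1) (badcount n (2 * A))) => c.
  rewrite addn1; move: c; rewrite -(ltr_nat R); lra.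
rewrite addn0; move: c; rewrite -(ler_nat R); lra.
Qed.

Lemma mass_badlevel n l : l = (n + 6)%N ->
  mass R (grid n) (badlevel l (grid n)) <= (grid n)%:R * 2^-1 ^+ (2 * l).
Proof.
move=> ->; apply: mass_bad_level; first lia.
  exact: grid_gt0.
by move=> b b1 bl; apply: dvdn_grid.
Qed.

Lemma mass_block B M c P : (c < B)%N ->
  mass R M (fun i => P (c * M + i)%N) <= mass R (B * M) P.
Proof.
move=> cB; rewrite mass_mul (bigD1 (Ordinal cB)) //= lerDl.
by apply: sumr_ge0 => w _; apply: mass_ge0.
Qed.

Lemma numer_lt n : (numer n < 2 ^ n)%N.
Proof.
elim: n => //= n IH; rewrite expnS; case: digit; lia.
Qed.

(** The old levels gain no proportion when the grid is refined, and the new level adds at most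
    [2 ^- n.+2], the increment that the invariant allows. *)
Lemma invariantP n : invariant n.
Proof.
elim: n => [|n IH].
  rewrite /invariant.
  have -> : (2 * mesh 0)%N = grid 0 by rewrite -mesh_mul expn1 mulnC.
  apply: le_trans (_ : mass R (grid 0) (badlevel 6 (grid 0)) <= _).
    apply: mass_mono => a _; rewrite mul0n add0n => /isbadP[i].
    by rewrite ltnS leqn0 => /eqP ->.
  apply: le_trans (mass_badlevel (erefl _)) _; rewrite ler_wpM2l //.
  apply: le_trans (_ : 2^-1 ^+ 1 <= _); last by rewrite expr1; lra.
  by apply: ler_wiXn2l => //; lra.
have H := invariant_half IH; rewrite /invariant.
have [C EC] := dvdnP (grid_dvdS n).
have C0 : (0 < C)%N by case: C EC (grid_gt0 n.+1) => // ->.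
have EK : (2 * mesh n.+1 = mesh n * C)%N.
  have := mesh_mul n.+1; rewrite EC -mesh_mul expnS => e.
  apply/eqP; rewrite -(eqn_pmul2r (_ : 0 < 2 ^ n.+1))%N ?expn_gt0 //; lia.
set A := numer n.+1 in H *; rewrite EK.
pose P1 i := isbad n (grid n.+1) (A * (mesh n * C) + i).
pose P2 i := badlevel (n.+1 + 6) (grid n.+1) (A * (mesh n * C) + i).
apply: le_trans (_ : mass R (mesh n * C) (fun i => P1 i \/ P2 i) <= _).
  apply: mass_mono => a _ /isbadP[i]; rewrite ltnS leq_eqVlt => /predU1P[->|ni] bl.
    by right.
  by left; apply/isbadP; exists i.
apply: le_trans (mass_or _ _ _ _) _.
(* Each old grid point splits into [C] new ones, which by [bad_refine] are bad at an old level only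
   if the old point is. *)
have h1 : mass R (mesh n * C) P1 <= (mesh n * C)%:R * (1 - 2^-1 ^+ n.+1).
  rewrite mass_mul natrM mulrAC [leRHS]mulrC.
  apply: le_trans (_ : C%:R * mass R (mesh n) (fun i => isbad n (grid n) (A * mesh n + i)) <= _); last first.
    by rewrite ler_wpM2l.
  rewrite [X in C%:R * X]/mass mulr_sumr; apply: ler_sum => w _.
  have [b|nb] := asboolP (isbad _ _ _); first by rewrite mulr1 mass_le_card.
  rewrite mulr0 le_eqVlt; apply/orP; left; apply/eqP; apply: big1 => e _.
  have [/isbadP[i ni [b bl [b1 bd]]]|//] := asboolP; case: nb; apply/isbadP.
  exists i => //; exists b => //; split => //.
  have bM : (b ^ digits_needed (i + 6) %| grid n)%N by apply: dvdn_grid => //; lia.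
  apply: (@bad_refine b _ (grid n) C _ e _ _ (ltn_ord e) bM); first lia.
    exact: grid_gt0.
  move: bd; rewrite EC mulnC.
  by rewrite (_ : (A * (mesh n * C) + (w * C + e) = (A * mesh n + w) * C + e)%N) //; lia.
(* The new level has density at most [4 ^ - (n + 7)] on the whole grid. Even if all its bad points
   fall into the current interval, of length [2 ^- n.+1], their proportion there is at most
   [2 ^ - (n + 13)]. *)
have h2 : mass R (mesh n * C) P2 <= (mesh n * C)%:R * 2^-1 ^+ n.+2.
  apply: le_trans (mass_block (mesh n * C) (badlevel (n.+1 + 6) (grid n.+1)) (numer_lt n.+1)) _.
  have EG : (2 ^ n.+1 * (mesh n * C) = grid n.+1)%N.
    by rewrite EC -mesh_mul; lia.
  rewrite EG; apply: le_trans (mass_badlevel (erefl _)) _.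
  rewrite -EG natrM mulrAC mulrC ler_wpM2l //.
  rewrite natrX (_ : 2 * (n.+1 + 6) = n.+1 + (n.+1 + 12))%N; last lia.
  rewrite exprD mulrA -exprMn divff ?pnatr_eq0 // expr1n mul1r.
  apply: ler_wiXn2l; [lra|lra|lia].
have -> : 1 - 2^-1 ^+ n.+2 = (1 - 2^-1 ^+ n.+1) + 2^-1 ^+ n.+2 :> R.
  by rewrite [2^-1 ^+ n.+2]exprS; lra.
by rewrite mulrDr lerD.
Qed.

End Invariant.

Lemma good_point (R : realType) n : exists2 i, (i < mesh n)%N &
  ~~ isbad n (grid n) (numer n.+1 * mesh n + i).
Proof.
apply: contrapT => no; have := invariant_half (invariantP R n).
rewrite (_ : mass _ _ _ = (mesh n)%:R).
  rewrite ler_pMr ?ltr0n ?mesh_gt0 // leNgt => /negP; apply.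
  by rewrite gtrBl exprn_gt0.
rewrite /mass -[RHS]mulr1 mulr_natl -[X in _ *+ X]card_ord -sumr_const.
apply: eq_bigr => i _; have [//|nb] := asboolP; case: no.
by exists i => //; apply/negP.
Qed.

(** * From grid points to their limit *)

Section Limit.
Variable R : realType.

Definition dgt (n : nat) : bool := digit n (numer n).

Definition expansion (n : nat) : R := \sum_(0 <= i < n) (dgt i)%:R / 2 ^+ i.+1.

Definition normal_number : R := limn expansion.

Lemma expansionE n : expansion n = (numer n)%:R / 2 ^+ n.
Proof.
rewrite /expansion; elim: n => [|n IH]; first by rewrite big_geq // mul0r.
rewrite big_nat_recr //= IH -/(dgt n) natrD natrM exprS.
have : 2 ^+ n != 0 :> R by rewrite expf_neq0.
by move: (2 ^+ n) => u u0; field.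
Qed.

Lemma expansion_nondecreasing : {homo expansion : n m / (n <= m)%N >-> n <= m}.
Proof.
apply/nondecreasing_seqP => n; rewrite /expansion big_nat_recr //= lerDl.
by rewrite divr_ge0 // exprn_ge0.
Qed.

Lemma expansion_step_le n m : (n <= m)%N ->
  expansion m + 2^-1 ^+ m <= expansion n + 2^-1 ^+ n.
Proof.
move=> /subnK <-; elim: (m - n)%N => [|k IH] //.
apply: le_trans IH; rewrite /expansion addSn big_nat_recr //= -/(expansion _).
rewrite -addrA lerD2l exprVn exprVn exprS invfM.
have : 0 <= (2 ^+ (k + n))^-1 :> R by rewrite invr_ge0 exprn_ge0.
by move: (_^-1) => u u0; case: dgt; rewrite ?mul1r ?mul0r; lra.
Qed.

Lemma expansion_bound n m : expansion m <= expansion n + 2^-1 ^+ n.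
Proof.
have [nm|mn] := leqP n m.
  apply: le_trans (expansion_step_le nm).
  by rewrite lerDl exprn_ge0 // invr_ge0.
apply: le_trans (expansion_nondecreasing (ltnW mn)) _.
by rewrite lerDl exprn_ge0 // invr_ge0.
Qed.

Lemma expansion_cvg : cvgn expansion.
Proof.
apply: nondecreasing_is_cvgn; first exact: expansion_nondecreasing.
by exists (expansion 0 + 2^-1 ^+ 0) => _ [n _ <-]; apply: expansion_bound.
Qed.

Lemma normal_number_expansion : binary_expansion dgt normal_number.
Proof. exact: expansion_cvg. Qed.

Lemma normal_number_itv n :
  (numer n)%:R / 2 ^+ n <= normal_number <= ((numer n)%:R + 1) / 2 ^+ n.
Proof.
rewrite mulrDl mul1r -expansionE -exprVn; apply/andP; split.
  exact: (nondecreasing_cvgn_le expansion_nondecreasing expansion_cvg).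
by apply: limr_le; [exact: expansion_cvg | near=> m; exact: expansion_bound].
Unshelve. all: by end_near. Qed.

(** The good point and the limit lie in the same closed dyadic interval of length [2 ^- n.+1]. *)
Lemma good_approximation n : exists a, [/\ ~~ isbad n (grid n) a &
  `|a%:R / (grid n)%:R - normal_number| <= 2^-1 ^+ n.+1].
Proof.
have [i iK gi] := good_point R n; exists (numer n.+1 * mesh n + i)%N; split => //.
have /andP[x1 x2] := normal_number_itv n.+1.
have K0 : 0 < (mesh n)%:R :> R by rewrite ltr0n mesh_gt0.
have P0 : 0 < 2 ^+ n.+1 :> R by rewrite exprn_gt0.
have E : (numer n.+1 * mesh n + i)%:R / (grid n)%:R =
    ((numer n.+1)%:R + i%:R / (mesh n)%:R) / 2 ^+ n.+1 :> R.
  rewrite -mesh_mul natrM natrX natrD natrM.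
  by field; rewrite !gt_eqF.
have y0 : 0 <= i%:R / (mesh n)%:R :> R by rewrite divr_ge0 // ltW.
have y1 : i%:R / (mesh n)%:R <= 1 :> R by rewrite ler_pdivrMr // mul1r ler_nat ltnW.
rewrite E exprVn; move: x1 x2; rewrite !mulrDl mul1r => x1 x2.
have : 0 <= i%:R / (mesh n)%:R / 2 ^+ n.+1 :> R by rewrite divr_ge0 // ltW.
have : i%:R / (mesh n)%:R / 2 ^+ n.+1 <= (2 ^+ n.+1)^-1 :> R.
  by rewrite ler_piMl // invr_ge0 ltW.
by move=> h1 h2; rewrite ler_norml; lra.
Qed.

Lemma normal_number_ge0 : 0 <= normal_number.
Proof. by have /andP[] := normal_number_itv 0; rewrite mul0r. Qed.

End Limit.

(** * Counting on neighbouring arcs of a circle *)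

Lemma truncn_frac (R : realType) (B : nat) (y : R) : (0 < B)%N -> 0 <= y ->
  Num.truncn (B%:R * frac_part y) = (Num.truncn (B%:R * y) %% B)%N.
Proof.
move=> B0 y0; rewrite /frac_part.
have [m Em] : exists m : nat, Num.floor y = m%:Z.
  have : 0 <= Num.floor y by rewrite floor_ge0.
  by case: (Num.floor y) => // m _; exists m.
have /andP[f1 f2] := floor_itv y; rewrite Em -pmulrn in f1 *.
rewrite Em intrD -!pmulrn in f2.
have B0' : 0 < B%:R :> R by rewrite ltr0n.
set q := Num.truncn (B%:R * (y - m%:R)).
have z0 : 0 <= B%:R * (y - m%:R) by rewrite mulr_ge0 // subr_ge0.
have /andP[q1 q2] := truncn_itv z0; rewrite -/q in q1 q2.
have qB : (q < B)%N.
  rewrite -(ltr_nat R); apply: le_lt_trans q1 _.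
  by rewrite -[ltRHS]mulr1 ltr_pM2l //; lra.
suff -> : Num.truncn (B%:R * y) = (m * B + q)%N by rewrite modnMDl modn_small.
apply: truncn_def; rewrite -addnS !natrD natrM; rewrite mulrBr in q1 q2.
by apply/andP; split; lra.
Qed.

(* [q] and [w] number arcs of a circle cut into [B] arcs.  A grid point slightly
   smaller than [x] may have the orbit point of [x] near 0 appear near 1. *)
Definition circ_adjacent (B q w : nat) : Prop :=
  [\/ (w <= q.+1 /\ q <= w.+1)%N, w = 0%N /\ q = B.-1 | w = B.-1 /\ q = 0%N].

Lemma modn_adjacent B f f' : (1 < B)%N -> (f <= f'.+1)%N -> (f' <= f.+1)%N ->
  circ_adjacent B (f %% B) (f' %% B).
Proof.
move=> B1 h1 h2.
have B0 : (0 < B)%N by lia.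
have S g : ((g.+1 %% B = (g %% B).+1) \/ (g %% B = B.-1 /\ g.+1 %% B = 0))%N.
  rewrite -addn1 -modnDml addn1; have := ltn_pmod g B0.
  rewrite leq_eqVlt => /predU1P[e|lt]; last by left; rewrite modn_small.
  by right; rewrite e modnn; split => //; lia.
have : f' = f \/ f' = f.+1 \/ f = f'.+1 by lia.
case=> [->|[->|->]]; first by constructor 1; lia.
  by have [->|[-> ->]] := S f; [constructor 1; lia | constructor 2].
by have [->|[-> ->]] := S f'; [constructor 1; lia | constructor 3].
Qed.

(** Here and below, [s] tells whether an orbit point of the limit lies in [[u, v)], [q] is its arc,
    [w] the arc of the grid orbit, and [U], [V] are the arcs of [u], [v]. Points in arcs strictly
    between those of the ends are inside, and a neighbour shifts the range by one arc. *)
Lemma indicator_lower B U V q w (s : bool) : (V <= B)%N -> (w < B)%N ->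
  circ_adjacent B q w -> ((U < q < V)%N -> s) ->
  ((w < V.-1) <= s + (w < U + 2))%N.
Proof.
move=> VB wB a h; case: (ltnP w V.-1) => // wV.
case: (ltnP w (U + 2)) => wU; rewrite ?addn1 // h //.
by case: a => [[a1 a2]|[a1 a2]|[a1 a2]]; apply/andP; split; lia.
Qed.

Lemma indicator_upper B U V q w (s : bool) : (V + 2 <= B)%N ->
  (0 < U)%N -> (U <= V)%N -> circ_adjacent B q w -> (s -> (U <= q <= V)%N) ->
  (s + (w < U.-1) <= (w < V + 2))%N.
Proof.
move=> VB U0 UV a; case: s => [/(_ isT)/andP[h1 h2]|_].
  have wV : (w < V + 2)%N by case: a => [[a1 a2]|[a1 a2]|[a1 a2]]; lia.
  have wU : (U.-1 <= w)%N by case: a => [[a1 a2]|[a1 a2]|[a1 a2]]; lia.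
  by rewrite wV ltnNge wU.
by case: (ltnP w U.-1) => //= l; rewrite (_ : (w < V + 2)%N) //; lia.
Qed.

(** For [U = 0] the neighbour may wrap around to the last arc, which enters as the complement of
    [w < B.-1]. *)
Lemma indicator_upper_low B V q w (s : bool) : (V + 2 <= B)%N -> circ_adjacent B q w -> (s -> (q <= V)%N) ->
  (s + (w < B.-1) <= (w < V + 2) + 1)%N.
Proof.
move=> VB a; case: s => [/(_ isT) h|_].
  rewrite add1n addn1; case: (ltnP w B.-1) => // wB1.
  have -> // : (w < V + 2)%N by case: a => [[a1 a2]|[a1 a2]|[a1 a2]]; lia.
by rewrite add0n addn1 (leq_trans (leq_b1 _)).
Qed.

(** For [V] near the top the neighbour may wrap around to arc 0, which enters as [w < 1]. *)
Lemma indicator_upper_high B U q w (s : bool) : (0 < U)%N ->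
  circ_adjacent B q w -> (s -> (U <= q)%N) ->
  (s + (w < U.-1) <= (w < 1) + 1)%N.
Proof.
move=> U0 a; case: s => [/(_ isT) h|_].
  rewrite add1n addn1; case: (ltnP w U.-1) => // wU.
  have -> // : (w < 1)%N by case: a => [[a1 a2]|[a1 a2]|[a1 a2]]; lia.
by rewrite add0n addn1 (leq_trans (leq_b1 _)).
Qed.

(** The pointwise comparisons are summed: the count is compared with two counts of words, each known
    within [E], and rounding to neighbouring arcs costs at most four arcs. *)
Lemma count_transfer (R : realType) (N B : nat) (z : nat -> R) (w : nat -> nat)
    (E u v : R) : (0 < B)%N -> 0 <= u -> u < v -> v <= 1 ->
  (forall j, (j < N)%N -> 0 <= z j < 1) ->
  (forall j, (j < N)%N -> (w j < B)%N) ->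
  (forall j, (j < N)%N -> circ_adjacent B (Num.truncn (B%:R * z j)) (w j)) ->
  (forall t, (t <= B)%N ->
    `|(\sum_(j < N) (w j < t)%N)%N%:R - N%:R * t%:R / B%:R| <= E) ->
  `|(\sum_(j < N) (u <= z j < v)%R)%N%:R - N%:R * (v - u)| <=
    2 * E + 4 * (N%:R / B%:R).
Proof.
move=> B1 u0 uv v1 z01 wB adj dist.
have B0 : 0 < B%:R :> R by rewrite ltr0n.
have [U EU] : exists U, U = Num.truncn (B%:R * u) by eexists.
have [V EV] : exists V, V = Num.truncn (B%:R * v) by eexists.
have Bu0 : 0 <= B%:R * u by rewrite mulr_ge0 // ltW.
have Bv0 : 0 <= B%:R * v by rewrite mulr_ge0 // ltW // (le_lt_trans u0).
have /andP[U1 U2] := truncn_itv Bu0; have /andP[V1 V2] := truncn_itv Bv0.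
have UV : (U <= V)%N by rewrite EU EV; apply: le_truncn; rewrite ler_pM2l // ltW.
have inq j : (j < N)%N -> u <= z j < v ->
    (U <= Num.truncn (B%:R * z j) <= V)%N.
  move=> jN /andP[h1 h2]; rewrite EU EV.
  by apply/andP; split; apply: le_truncn; rewrite ler_pM2l // ltW.
rewrite -EU in U1 U2; rewrite -EV in V1 V2.
have VB : (V <= B)%N.
  by rewrite -(ler_nat R); apply: le_trans V1 _; rewrite ler_piMr // ltW.
have qin j : (j < N)%N -> (U < Num.truncn (B%:R * z j) < V)%N -> u <= z j < v.
  move=> jN /andP[h1 h2]; have /andP[z0 _] := z01 j jN.
  have /andP[t1 t2] := truncn_itv (mulr_ge0 (ltW B0) z0).
  rewrite -(ler_pM2l B0) -[z j < v](ltr_pM2l B0); apply/andP; split.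
    by apply: le_trans (ltW U2) _; apply: le_trans t1; rewrite ler_nat.
  by apply: lt_le_trans t2 _; apply: le_trans V1; rewrite ler_nat.
clear EU EV Bu0 Bv0.
have [C EC] : exists C, C = (\sum_(j < N) (u <= z j < v)%R)%N by eexists.
have [F EF] : exists F : nat -> nat, F = fun t => (\sum_(j < N) (w j < t)%N)%N by eexists.
have cN : (N = \sum_(j < N) 1)%N by rewrite sum_nat_const card_ord muln1.
have P1 : (F V.-1 <= C + F (U + 2))%N.
  rewrite EF EC -big_split /=; apply: leq_sum => -[j jN] _ /=.
  exact: (indicator_lower VB (wB j jN) (adj j jN) (qin j jN)).
have P2 : (V + 2 <= B)%N -> (C + F B.-1 <= F (V + 2) + N)%N.
  rewrite EF EC [X in (_ <= _ + X)%N]cN -!big_split /= => VB2; apply: leq_sum => -[j jN] _ /=.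
  by apply: (indicator_upper_low VB2 (adj j jN)) => /(inq j jN)/andP[].
have P3 : (0 < U)%N -> (V + 2 <= B)%N -> (C + F U.-1 <= F (V + 2))%N.
  move=> U0; rewrite EF EC -!big_split /= => VB2; apply: leq_sum => -[j jN] _ /=.
  exact: (indicator_upper VB2 U0 UV (adj j jN) (inq j jN)).
have P4 : (0 < U)%N -> (C + F U.-1 <= F 1 + N)%N.
  rewrite EF EC [X in (_ <= _ + X)%N]cN -!big_split /= => U0; apply: leq_sum => -[j jN] _ /=.
  by apply: (indicator_upper_high U0 (adj j jN)) => /(inq j jN)/andP[].
have P5 : (C <= N)%N.
  by rewrite EC [X in (_ <= X)%N]cN; apply: leq_sum => j _; case: (_ <= _ < _)%R.
have [c Ec] : exists c : R, c = N%:R / B%:R by eexists.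
have c0 : 0 <= c by rewrite Ec divr_ge0 // ltW.
have bnd t : (t <= B)%N -> c * t%:R - E <= (F t)%:R <= c * t%:R + E.
  move=> tB; have := dist t tB; rewrite EF Ec ler_norml mulrAC => /andP[h1 h2].
  by apply/andP; split; lra.
have EN : N%:R = c * B%:R :> R by rewrite Ec divfK // gt_eqF.
have E0 : 0 <= E by apply: le_trans (normr_ge0 _) (dist 0%N (leq0n B)).
rewrite -EC -Ec (_ : N%:R * (v - u) = c * (B%:R * v) - c * (B%:R * u)); last first.
  by rewrite !mulrA -EN mulrBr.
have V3 : B%:R * v <= B%:R by rewrite ler_piMr // ltW.
move: (B%:R * u) (B%:R * v) U1 U2 V1 V2 V3 => x y U1 U2 V1 V2 V3.
rewrite -natr1 in U2; rewrite -natr1 in V2.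
have mU1 := ler_wpM2l c0 U1; have mU2 := ler_wpM2l c0 (ltW U2).
have mV1 := ler_wpM2l c0 V1; have mV2 := ler_wpM2l c0 (ltW V2).
have mV3 := ler_wpM2l c0 V3.
rewrite mulrDr mulr1 in mU2; rewrite mulrDr mulr1 in mV2.
have pred t : c * t.-1%:R >= c * t%:R - c.
  by case: t => [|t] /=; rewrite ?mulr0 -?natr1; lra.
have bp t : (t <= B)%N -> c * t%:R - c - E <= (F t.-1)%:R.
  by move=> tB; have /andP[] := bnd t.-1 (leq_trans (leq_pred t) tB); have := pred t; lra.
have b2 t : (t + 2 <= B)%N -> (F (t + 2))%:R <= c * t%:R + 2 * c + E.
  by move=> tB; have /andP[_] := bnd _ tB; rewrite natrD mulrDr; lra.
have near_top t : (B < t + 2)%N -> c * B%:R <= c * t%:R + c.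
  move=> tB; rewrite -{3}[c]mulr1 -mulrDr ler_wpM2l // natr1 ler_nat.
  by rewrite addn2 ltnS in tB.
have {bnd}b1 : (F 1)%:R <= c + E by have /andP[_] := bnd 1%N B1; rewrite mulr1.
clear U1 U2 V1 V2 V3 pred EF EC adj inq qin wB z01 dist cN Ec uv u0 v1 B0.
have Lo : c * y - c * x - (2 * E + 4 * c) <= C%:R.
  have [UB|UB] := leqP (U + 2) B.
    by move: P1; rewrite -(ler_nat R) natrD; have := b2 U UB; have := bp V VB; lra.
  by have := near_top U UB; have := ler0n R C; lra.
suff Up : C%:R <= c * y - c * x + (2 * E + 4 * c).
  by rewrite ler_norml; apply/andP; split; lra.
(* The cases are whether the interval reaches the lowest arc and whether it comes near the top; when
   it does both, the trivial bound [C <= N] suffices. *)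
have [U0|U0] := posnP U; have [VB2|VB2] := leqP (V + 2) B.
- have := P2 VB2; rewrite -(ler_nat R) !natrD EN.
  have := b2 V VB2; have := bp B (leqnn B).
  by rewrite U0 in mU2; lra.
- have := P5; rewrite -(ler_nat R) EN.
  by have := near_top V VB2; rewrite U0 in mU2; lra.
- have := P3 U0 VB2; rewrite -(ler_nat R) !natrD.
  by have := b2 V VB2; have := bp U (leq_trans UV VB); lra.
- have := P4 U0; rewrite -(ler_nat R) !natrD EN.
  by have := near_top V VB2; have := bp U (leq_trans UV VB); lra.
Qed.

(** The word at position [j] consists of the last [h] of the first [j + h] digits. *)
Lemma wrd_mod b h j M a : (0 < b)%N -> (0 < M)%N -> (b ^ (j + h) %| M)%N ->
  wrd b h M a j = ((b ^ (j + h) * a %/ M) %% b ^ h)%N.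
Proof.
move=> b0 M0 /dvdnP[M2 EM].
have M20 : (0 < M2)%N by case: M2 EM M0 => // ->.
have EM' : M = (b ^ j * (b ^ h * M2))%N by rewrite EM expnD; lia.
rewrite {1}EM' wrdE // -modn_divl EM [(M2 * _)%N]mulnC divnMl //.
by rewrite expn_gt0 b0.
Qed.

Lemma truncn_near (R : realType) (y z : R) : 0 <= y -> 0 <= z -> `|y - z| <= 1 ->
  (Num.truncn y <= (Num.truncn z).+1)%N.
Proof.
move=> y0 z0; rewrite ler_norml => /andP[_ h].
have /andP[y1 _] := truncn_itv y0; have /andP[_ z1] := truncn_itv z0.
rewrite -ltnS -(ltr_nat R) -natr1; lra.
Qed.

Lemma truncn_divn (R : realType) (a M : nat) : (0 < M)%N ->
  Num.truncn (a%:R / M%:R : R) = (a %/ M)%N.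
Proof.
move=> M0; have M0' : 0 < M%:R :> R by rewrite ltr0n.
apply: truncn_def; rewrite ler_pdivlMr // ltr_pdivrMr // -!natrM ler_nat ltr_nat.
by rewrite leq_trunc_div ltn_ceil.
Qed.

(** * The discrepancy of the orbits and its upper limit *)

Section Discrepancy.
Variable R : realType.
Let x := normal_number R.

Lemma orbit_count b l N (u v : R) : (1 < b)%N -> (b <= l)%N -> (6 <= l)%N ->
  (2 ^ (2 ^ l) <= N < 2 ^ (2 ^ l.+1))%N -> 0 <= u -> u < v -> v <= 1 ->
  `|(\sum_(j < N) (u <= frac_part (b%:R ^+ j * x) < v)%R)%N%:R - N%:R * (v - u)| <=
    2 * (180 * Num.sqrt (l * N)%:R) + 4 * (N%:R / (b ^ (2 ^ l))%:R).
Proof.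
move=> b1 bl l6 /andP[N1 N2] u0 uv v1; have b0 : (0 < b)%N by lia.
set H := (2 ^ l)%N; set B := (b ^ H)%N.
(* Large enough that level [l] is among those tested and that [b ^ (N + H) <= 2 ^ n.+1], so each of
   the first [N] orbit points moves by at most one arc. *)
pose n := (l + b ^ (N + H))%N.
have [a [ga da]] := good_approximation R n.
set M := grid n in ga da; have M0 : (0 < M)%N := grid_gt0 n.
have dM k : (k <= N + H)%N -> (b ^ k %| M)%N.
  move=> kN; apply: dvdn_trans (dvdn_grid b1 bl (_ : l <= n + 6)%N); last by rewrite /n; lia.
  apply: dvdn_exp2l; rewrite /digits_needed -/H; lia.
have x0 : 0 <= x := normal_number_ge0 R.
have B0 : (0 < B)%N by rewrite expn_gt0 b0.
apply: (@count_transfer R N B (fun j => frac_part (b%:R ^+ j * x)) (wrd b H M a)) => //.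
- move=> j _; rewrite /frac_part.
  have := floor_itv (b%:R ^+ j * x); rewrite intrD => /andP[h1 h2].
  by apply/andP; split; lra.
- by move=> j _; apply: wrd_lt.
- move=> j jN; have y0 : 0 <= b%:R ^+ j * x by rewrite mulr_ge0 // exprn_ge0.
  rewrite truncn_frac // wrd_mod //; last by apply: dM; lia.
  have B2 : (1 < B)%N by rewrite -(expn0 b) ltn_exp2l // expn_gt0.
  have E : (b ^ (j + H) * a %/ M)%N =
      Num.truncn (B%:R * (b%:R ^+ j * (a%:R / M%:R)) : R).
    rewrite -(@truncn_divn R) // !mulrA -natrX -!natrM; congr (Num.truncn (_%:R / _)).
    by rewrite expnD /B; lia.
  have y1 : 0 <= B%:R * (b%:R ^+ j * x) by rewrite mulr_ge0.
  have y2 : 0 <= B%:R * (b%:R ^+ j * (a%:R / M%:R)) :> R.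
    by rewrite !mulr_ge0 ?exprn_ge0 ?divr_ge0.
  have near1 : `|B%:R * (b%:R ^+ j * (a%:R / M%:R)) - B%:R * (b%:R ^+ j * x)| <= 1.
    rewrite -!mulrBr mulrA normrM ger0_norm; last by rewrite mulr_ge0 ?exprn_ge0.
    apply: le_trans (_ : (2 ^ n.+1)%:R * 2^-1 ^+ n.+1 <= _).
      apply: ler_pM => //.
      rewrite -natrX -natrM ler_nat /B -expnD.
      apply: leq_trans (_ : b ^ (N + H) <= _)%N; first by rewrite leq_exp2l //; lia.
      apply: leq_trans (ltnW (ltn_expl n.+1 (ltnSn 1))); rewrite /n; lia.
    by rewrite natrX -exprMn divff ?pnatr_eq0 // expr1n.
  rewrite E; apply: modn_adjacent => //; first by apply: truncn_near; rewrite // distrC.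
  exact: truncn_near.
- move=> t tB; rewrite -dev_cnt leNgt -(failE R l N t M a b0); apply/negP => fl.
  case/negP: ga; apply/isbadP; exists (l - 6)%N; first by rewrite /n; lia.
  rewrite subnK //; exists b; first by rewrite ltnS.
  by split => //; exists N, t; split; rewrite ?N1.
Qed.

Lemma discrepancy_le b l N : (1 < b)%N -> (b <= l)%N -> (6 <= l)%N ->
  (2 ^ (2 ^ l) <= N < 2 ^ (2 ^ l.+1))%N ->
  discrepancy N (fun j : nat => frac_part (b%:R ^+ j * x)) * Num.sqrt N%:R <=
    370 * Num.sqrt l%:R.
Proof.
move=> b1 bl l6 Nl; have /andP[N1 N2] := Nl.
have N0 : (0 < N)%N by apply: leq_trans N1; rewrite expn_gt0.
have N0' : 0 < N%:R :> R by rewrite ltr0n.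
set s := Num.sqrt N%:R; have s2 : s ^+ 2 = N%:R by rewrite sqr_sqrtr.
have s0 : 0 < s by rewrite sqrtr_gt0.
(* There are at least [2 ^ (2 ^ l)] arcs, and [N] is below the square of this number. *)
have NB : N%:R / (b ^ (2 ^ l))%:R <= s.
  have h0 : 0 < (2 ^ (2 ^ l))%:R :> R by rewrite ltr0n expn_gt0.
  have hB : 0 < (b ^ (2 ^ l))%:R :> R by rewrite ltr0n expn_gt0 (ltnW b1).
  rewrite ler_pdivrMr // -s2 expr2 ler_pM2l //.
  apply: le_trans (_ : (2 ^ (2 ^ l))%:R <= _); last by rewrite ler_nat leq_exp2r ?expn_gt0.
  rewrite -[leRHS]ger0_norm // -sqrtr_sqr ler_wsqrtr // -natrX ler_nat -expnM.
  by rewrite mulnC -expnS ltnW.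
set L := Num.sqrt l%:R.
have L1 : 1 <= L.
  by rewrite -[1]sqrtr1 ler_wsqrtr // (ler_nat R 1); lia.
rewrite -ler_pdivlMr //; apply: ge_sup.
  by exists (`|#|[pred j : 'I_N | (0 <= frac_part (b%:R ^+ j * x) < 1)%R]|%:R / N%:R - (1 - 0)|), 0, 1; split.
move=> _ [u [v [u0 uv v1 ->]]].
have -> : #|[pred j : 'I_N | u <= frac_part (b%:R ^+ j * x) < v]| =
    (\sum_(j < N) (u <= frac_part (b%:R ^+ j * x) < v)%R)%N.
  by rewrite -sum1_card big_mkcond.
have := orbit_count b1 bl l6 Nl u0 uv v1.
set C := (\sum_(j < N) _)%N => h.
have -> : C%:R / N%:R - (v - u) = (C%:R - N%:R * (v - u)) / N%:R.
  by rewrite mulrBl [N%:R * _]mulrC mulfK ?gt_eqF.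
rewrite normrM normfV [`|N%:R|]ger0_norm // ler_pdivrMr //.
apply: le_trans h _.
have -> : 370 * L / s * N%:R = 370 * L * s.
  by rewrite -s2 expr2 mulrA divfK ?gt_eqF.
rewrite natrM sqrtrM // -/s -/L.
apply: le_trans (_ : 2 * (180 * (L * s)) + 4 * s <= _); first by rewrite lerD2l ler_wpM2l.
have := ler_wpM2r (ltW s0) L1; rewrite mul1r; lra.
Qed.

(** [ln (ln N)] is at least [l * ln 2 + ln (ln 2) >= 6 / 10 * l - 1], and
    [(6 / 10 - (19 / 25) ^ 2) * l >= 1] from [l = 45] on. *)
Lemma lnln_ge l N : (45 <= l)%N -> (2 ^ (2 ^ l) <= N)%N ->
  19 / 25 * Num.sqrt l%:R <= Num.sqrt (ln (ln N%:R)) :> R.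
Proof.
move=> l45 lN.
have ln2 : 6 / 10 <= ln 2 :> R.
  have e1 : expR (1 / 10) <= 10 / 9 :> R.
    have := expR_ge1Dx (- (1 / 10) : R); rewrite expRN => h.
    rewrite -[expR _]invrK invf_ple ?posrE ?invr_gt0 ?expR_gt0 //; lra.
  rewrite -ler_expR lnK ?posrE //.
  have -> : 6 / 10 = 6%:R * (1 / 10) :> R by lra.
  rewrite expRM_natl; apply: le_trans (_ : (10 / 9) ^+ 6 <= _).
    by rewrite lerXn2r ?nnegrE ?expR_ge0 //; lra.
  by rewrite !exprS expr0; lra.
have h0 : 0 < ln 2 :> R by lra.
have step1 : (2 ^ l)%:R * ln 2 <= ln N%:R :> R.
  have -> : (2 ^ l)%:R * ln 2 = ln ((2 ^ (2 ^ l))%:R) :> R.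
    by rewrite [in RHS]natrX lnXn // mulr_natl.
  rewrite ler_ln ?posrE ?ltr0n ?ler_nat ?expn_gt0 //.
  by apply: leq_trans lN; rewrite expn_gt0.
have step2 : l%:R * ln 2 + ln (ln 2) <= ln (ln N%:R) :> R.
  have -> : l%:R * ln 2 + ln (ln 2) = ln ((2 ^ l)%:R * ln 2) :> R.
    rewrite lnM ?posrE ?ltr0n ?expn_gt0 //; congr (_ + _).
    by rewrite natrX lnXn // mulr_natl.
  rewrite ler_ln ?posrE ?mulr_gt0 ?ltr0n ?expn_gt0 //.
  by apply: lt_le_trans step1; rewrite mulr_gt0 ?ltr0n ?expn_gt0.
have step3 : - 1 <= ln (ln 2) :> R.
  have : ln (6 / 10) <= ln (ln 2) :> R by rewrite ler_ln ?posrE //; lra.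
  have : ln (10 / 6) <= 10 / 6 - 1 :> R.
    rewrite [X in ln X](_ : _ = 1 + (10 / 6 - 1)); last lra.
    by apply: le_ln1Dx; lra.
  have -> : 10 / 6 = (6 / 10)^-1 :> R by rewrite invf_div.
  rewrite lnV ?posrE; last lra.
  lra.
have l45' : 45 <= l%:R :> R by rewrite ler_nat.
rewrite -[19 / 25]ger0_norm // -sqrtr_sqr -sqrtrM ?sqr_ge0 // ler_wsqrtr //.
apply: le_trans step2.
have := ler_wpM2l (ler0n R l) ln2; rewrite expr2; lra.
Qed.

Lemma limn_esup_le (f : nat -> \bar R) (c : \bar R) N0 :
  (forall N, (N0 <= N)%N -> (f N <= c)%E) -> (limn_esup f <= c)%E.
Proof.
move=> h; rewrite /limn_esup limf_esupE.
apply: le_trans (ereal_inf_lbound _) _.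
  by exists [set N | (N0 <= N)%N]%classic; [exact: nbhs_infty_ge | reflexivity].
by apply: ge_ereal_sup => _ [N N0N <-]; apply: h.
Qed.

Lemma lil b : (2 <= b)%N ->
  (limn_esup (fun N : nat =>
     (discrepancy N (fun j : nat => frac_part (b%:R ^+ j * x))
        * Num.sqrt N%:R / Num.sqrt (ln (ln N%:R)))%:E)
   < (3 * lil_const R b)%:E)%E.
Proof.
(* An upper limit keeps only weak inequalities, so an intermediate constant is inserted:
   [370 * 25 / 19 < 490 < 3 * 166]. *)
move=> b2; apply: (@le_lt_trans _ _ (490 : R)%:E); last first.
  rewrite lte_fin /lil_const.
  have : 0 <= 664 / (Num.sqrt b%:R - 1) :> R.
    have : Num.sqrt 1 <= Num.sqrt b%:R :> R by rewrite ler_wsqrtr // ler1n; lia.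
    by rewrite sqrtr1 => b1; rewrite divr_ge0 // subr_ge0.
  move: (664 / _) => y y0; lra.
(* Beyond this length the level is at least [45 + b], so base [b] is tested and [lnln_ge]
   applies. *)
apply: (@limn_esup_le _ _ (2 ^ (2 ^ (45 + b)))%N) => N hN.
have N0 : (0 < N)%N by apply: leq_trans hN; rewrite expn_gt0.
have /andP[k1 k2] := @trunc_log_bounds 2 N (ltnSn 1) N0.
set k := trunc_log 2 N in k1 k2.
have kb : (2 ^ (45 + b) <= k)%N.
  by rewrite -ltnS -(ltn_exp2l _ _ (ltnSn 1)); apply: leq_ltn_trans hN k2.
have k0 : (0 < k)%N by apply: leq_trans kb; rewrite expn_gt0.
have /andP[l1 l2] := @trunc_log_bounds 2 k (ltnSn 1) k0.
set l := trunc_log 2 k in l1 l2.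
have lb : (45 + b <= l)%N.
  by rewrite -ltnS -(ltn_exp2l _ _ (ltnSn 1)); apply: leq_ltn_trans kb l2.
have N1 : (2 ^ (2 ^ l) <= N)%N by apply: leq_trans k1; rewrite leq_exp2l.
have N2 : (N < 2 ^ (2 ^ l.+1))%N by apply: leq_trans k2 _; rewrite leq_exp2l.
rewrite lee_fin; have l45 : (45 <= l)%N by lia.
have h1 := lnln_ge l45 N1.
have L0 : 0 < Num.sqrt l%:R :> R by rewrite sqrtr_gt0 ltr0n; lia.
rewrite ler_pdivrMr; last by apply: lt_le_trans h1; rewrite mulr_gt0.
have Nl : (2 ^ (2 ^ l) <= N < 2 ^ (2 ^ l.+1))%N by rewrite N1.
have [bl l6] : (b <= l)%N /\ (6 <= l)%N by split; lia.
apply: le_trans (discrepancy_le b2 bl l6 Nl) _.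
lra.
Qed.

End Discrepancy.

(** * The program *)

(** The value and the bound on loop lengths are established together, since loop lengths are
    themselves values. *)
Definition denotes (L : nat) (e : expr) (r : nat -> int) (z : int) : Prop :=
  loops_le L e r /\ eval e r = z.

Definition Lt e f := Bin ISub (Cst 1) (Bin ILe f e).
Definition Sum x i n e := Fold x i n (Cst 0) (Bin IAdd (Var x) e).
Definition Pow x i b n := Fold x i n (Cst 1) (Bin IMul (Var x) b).
(** Repeated squaring: [b ^ (2 ^ n)] in [n] rounds. *)
Definition Sqs x i b n := Fold x i n b (Bin IMul (Var x) (Var x)).

Section Denotes.
Variables (L : nat) (r : nat -> int).

Lemma denotes_var x z : r x = z -> denotes L (Var x) r z.
Proof. by []. Qed.

Lemma denotes_cst z : denotes L (Cst z) r z.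
Proof. by []. Qed.

Lemma denotes_bin op e f a b z : denotes L e r a -> denotes L f r b ->
  int_op_eval op a b = z -> denotes L (Bin op e f) r z.
Proof. by move=> [l1 <-] [l2 <-] <-. Qed.

Lemma denotes_add e f (a b : nat) : denotes L e r a%:Z -> denotes L f r b%:Z ->
  denotes L (Bin IAdd e f) r (a + b)%N%:Z.
Proof. by move=> h1 h2; apply: denotes_bin h1 h2 _. Qed.

Lemma denotes_succ e (a : nat) : denotes L e r a%:Z ->
  denotes L (Bin IAdd e (Cst 1%N)) r a.+1%:Z.
Proof. by move=> h; apply: denotes_bin h (denotes_cst _) _; rewrite /= -PoszD addn1. Qed.

Lemma denotes_mul e f (a b : nat) : denotes L e r a%:Z -> denotes L f r b%:Z ->
  denotes L (Bin IMul e f) r (a * b)%N%:Z.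
Proof. by move=> h1 h2; apply: denotes_bin h1 h2 _. Qed.

Lemma denotes_sub e f (a b : nat) : (b <= a)%N ->
  denotes L e r a%:Z -> denotes L f r b%:Z ->
  denotes L (Bin ISub e f) r (a - b)%N%:Z.
Proof. by move=> ba h1 h2; apply: denotes_bin h1 h2 _; rewrite /= subzn. Qed.

Lemma denotes_div e f (a b : nat) : denotes L e r a%:Z -> denotes L f r b%:Z ->
  denotes L (Bin IDiv e f) r (a %/ b)%N%:Z.
Proof. by move=> h1 h2; apply: denotes_bin h1 h2 _; rewrite /= divz_nat. Qed.

Lemma denotes_mod e f (a b : nat) : denotes L e r a%:Z -> denotes L f r b%:Z ->
  denotes L (Bin IMod e f) r (a %% b)%N%:Z.
Proof. by move=> h1 h2; apply: denotes_bin h1 h2 _; rewrite /= modz_nat. Qed.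

Lemma denotes_lt e f (a b : int) (c : bool) : denotes L e r a -> denotes L f r b ->
  (a < b) = c -> denotes L (Lt e f) r (c : nat)%:Z.
Proof.
move=> h1 h2 <-; apply: denotes_bin (denotes_cst 1) (denotes_bin h2 h1 erefl) _.
by rewrite /= ltNge; case: (_ <= _).
Qed.

Lemma denotes_let x e f a z :
  denotes L e r a -> denotes L f (upd r x a) z -> denotes L (Let x e f) r z.
Proof. by move=> [l1 <-] [l2 <-]. Qed.

Lemma denotes_sum x i n e (m : nat) (f : nat -> nat) : x != i ->
  denotes L n r m%:Z -> (m <= L)%N ->
  (forall k a, (k < m)%N -> denotes L e (upd (upd r x a) i k%:Z) (f k)%:Z) ->
  denotes L (Sum x i n e) r (\sum_(0 <= k < m) f k)%N%:Z.
Proof.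
move=> xi [ln En] mL h; split=> /=.
  split; rewrite ?En // => k a km; split => //.
  by have [] := h k a km.
rewrite En /=; have {mL} : (m <= m)%N by [].
elim: {-2}m => [|k IH] km; first by rewrite big_geq.
rewrite big_nat_recr //= PoszD IH 1?ltnW // !updE (negbTE xi) eqxx; congr (_ + _).
exact: (proj2 (h k _ km)).
Qed.

Lemma denotes_pow x i b n (m B : nat) : x != i ->
  denotes L n r m%:Z -> (m <= L)%N ->
  (forall k a, (k < m)%N -> denotes L b (upd (upd r x a) i k%:Z) B%:Z) ->
  denotes L (Pow x i b n) r (B ^ m)%N%:Z.
Proof.
move=> xi [ln En] mL h; split=> /=.
  split; rewrite ?En // => k a km; split => //.
  by have [] := h k a km.
rewrite En /=; have {mL} : (m <= m)%N by [].
elim: {-2}m => [|k IH] km; first by rewrite expn0.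
rewrite expnSr PoszM /= IH 1?ltnW // !updE (negbTE xi) eqxx; congr (_ * _).
exact: (proj2 (h k _ km)).
Qed.

Lemma denotes_sqs x i b n (m B : nat) : x != i ->
  denotes L b r B%:Z -> denotes L n r m%:Z -> (m <= L)%N ->
  denotes L (Sqs x i b n) r (B ^ (2 ^ m))%N%:Z.
Proof.
move=> xi [lb Eb] [ln En] mL; split=> /=; first by rewrite En.
rewrite En /= {En mL}; elim: m => [|k IH] //=.
by rewrite IH !updE (negbTE xi) eqxx expnS mulnC expnM expnS expn1 PoszM.
Qed.

Lemma denotes_fact x i n (m : nat) : x != i ->
  denotes L n r m%:Z -> (m <= L)%N ->
  denotes L (Fold x i n (Cst 1) (Bin IMul (Bin IAdd (Var i) (Cst 1)) (Var x))) r m`!%:Z.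
Proof.
move=> xi [ln En] mL; split=> /=; first by rewrite En.
rewrite En /= {En mL}; elim: m => [|k IH] //=.
by rewrite IH !updE (negbTE xi) !eqxx factS PoszM -addn1 PoszD.
Qed.

End Denotes.

(* Registers 0 and 1 hold the stage and the numerator of the left end of the
   current dyadic interval between two stages. *)
Local Notation vn := 0%N. Local Notation vA := 1%N. Local Notation vm := 3%N.
Local Notation vD := 4%N. Local Notation vlen := 5%N. Local Notation vM := 6%N.
Local Notation vK := 7%N. Local Notation va := 8%N. Local Notation vl := 9%N.
Local Notation vP := 10%N. Local Notation vb := 11%N. Local Notation vB := 12%N.
Local Notation vN := 13%N. Local Notation vd := 14%N. Local Notation vi := 15%N.
Local Notation vj := 16%N. Local Notation vk := 17%N. Local Notation vv := 18%N.
Local Notation vt := 19%N. Local Notation vs := 20%N.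
Local Notation "e #+ f" := (Bin IAdd e f) (at level 50, left associativity).
Local Notation "e #- f" := (Bin ISub e f) (at level 50, left associativity).
Local Notation "e #* f" := (Bin IMul e f) (at level 40, left associativity).
Local Notation "e #/ f" := (Bin IDiv e f) (at level 40, left associativity).
Local Notation "e #% f" := (Bin IMod e f) (at level 40, left associativity).
Local Coercion Var : nat >-> expr.

Definition cnt_expr :=
  Sum 30 vt vN (Lt ((Pow 31 vs vb vt #* va) #% vM #* vB #/ vM) vv).

Definition fail_expr :=
  Let vd (cnt_expr #* vB #- vN #* vv)
    (Lt (Cst 180%N #* Cst 180%N #* vN #* vl #* (vB #* vB)) (vd #* vd)).

Definition badsum_expr :=
  Sum 32 vi (vn #+ Cst 1%N)
    (Let vl (vi #+ Cst 6%N) (Let vP (Sqs 33 34 (Cst 2%N) vl)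
      (Sum 35 vj (vi #+ Cst 5%N)
        (Let vb (vj #+ Cst 2%N) (Let vB (Sqs 33 34 vb vl)
          (Sum 36 vk (vP #* vP #- vP)
            (Let vN (vP #+ vk) (Sum 37 vv (vB #+ Cst 1%N) fail_expr)))))))).

Definition badcount_expr (c : expr) :=
  Sum 38 39 vK (Let va (c #* vK #+ 39%N) (Lt (Cst 0%N) badsum_expr)).

Definition digit_expr :=
  Let vm (vn #+ Cst 6%N)
    (Let vD (Fold 40 41 vm (Cst 1%N) ((41%N #+ Cst 1%N) #* 40%N))
      (Let vlen (Sqs 40 41 (Cst 2%N) (vm #+ Cst 2%N))
        (Let vM (Pow 40 41 vD vlen)
          (Let vK (vM #/ Pow 40 41 (Cst 2%N) (vn #+ Cst 1%N))
            (Lt (badcount_expr (Cst 2%N #* vA #+ Cst 1%N))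
                (badcount_expr (Cst 2%N #* vA))))))).

Lemma denotes_cnt L r b h M a N v :
  r vM = M%:Z -> r va = a%:Z -> r vB = (b ^ h)%N%:Z -> r vN = N%:Z ->
  r vb = b%:Z -> r vv = v%:Z -> (N <= L)%N ->
  denotes L cnt_expr r (cnt b h M a N v)%:Z.
Proof.
move=> hM ha hB hN hb hv NL.
rewrite /cnt -(big_mkord xpredT (fun j => nat_of_bool (wrd b h M a j < v)%N)).
apply: denotes_sum => // k x kN.
apply: (denotes_lt (a := (wrd b h M a k)%:Z) (b := v%:Z)) => //.
apply: denotes_div => //; apply: denotes_mul => //; apply: denotes_mod => //.
apply: denotes_mul => //; apply: denotes_pow => //.
by apply: leq_trans (ltnW kN) NL.
Qed.

Lemma denotes_fail L r b l M a N v :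
  r vM = M%:Z -> r va = a%:Z -> r vB = (b ^ (2 ^ l))%N%:Z -> r vN = N%:Z ->
  r vb = b%:Z -> r vl = l%:Z -> r vv = v%:Z -> (N <= L)%N ->
  denotes L fail_expr r (fail b l N v M a : nat)%:Z.
Proof.
move=> hM ha hB hN hb hl hv NL.
set x : int := (cnt b (2 ^ l) M a N v)%:Z * (b ^ (2 ^ l))%N%:Z - N%:Z * v%:Z.
apply: (denotes_let (a := x)).
  apply: (denotes_bin (a := (cnt b (2 ^ l) M a N v)%:Z * (b ^ (2 ^ l))%N%:Z)
    (b := N%:Z * v%:Z)) => //.
    apply: (denotes_bin _ (denotes_var _ hB)); last by [].
    exact: denotes_cnt hM ha hB hN hb hv NL.
  exact: (denotes_bin (denotes_var _ hN) (denotes_var _ hv)).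
apply: (denotes_lt (a := 180%:Z * 180%:Z * N%:Z * l%:Z * ((b ^ 2 ^ l)%N%:Z * (b ^ 2 ^ l)%N%:Z))
  (b := x * x)).
- by rewrite -!PoszM; do !apply: denotes_mul.
- exact: denotes_bin (denotes_var _ erefl) (denotes_var _ erefl) _.
- by [].
Qed.

Lemma denotes_badsum L r n M a : r vn = n%:Z -> r vM = M%:Z -> r va = a%:Z ->
  (2 ^ (2 ^ (n + 6).+1) <= L)%N ->
  (forall b, (b <= n + 6)%N -> (b ^ (2 ^ (n + 6)) < L)%N) ->
  denotes L badsum_expr r (badsum n M a)%:Z.
Proof.
move=> hn hM ha PL BL.
have PP i : (i < n.+1)%N -> (2 ^ (2 ^ (i + 6)) * 2 ^ (2 ^ (i + 6)) <= L)%N.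
  move=> ni; apply: leq_trans PL; rewrite -expnD leq_exp2l // addnn -mul2n -expnS.
  by rewrite leq_exp2l; lia.
have nL : (n + 7 <= L)%N.
  apply: leq_trans PL; rewrite addnS; apply: leq_trans (ltnW (ltn_expl _ (ltnSn 1))) _.
  by rewrite leq_exp2l // ltnW // ltn_expl.
rewrite /badsum; apply: denotes_sum => //; [exact: denotes_succ | lia |] => i x ni; apply: denotes_let; first by apply: denotes_add.
apply: denotes_let; first by apply: denotes_sqs => //; lia.
apply: denotes_sum => //; [lia |] => j y ji.
apply: denotes_let; first by apply: denotes_add.
apply: denotes_let; first by apply: denotes_sqs => //; lia.
have bL : ((j + 2) ^ (2 ^ (i + 6)) < L)%N.
  apply: leq_ltn_trans (BL (j + 2)%N _); last lia.
  by rewrite leq_exp2l ?leq_exp2l //; lia.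
apply: denotes_sum => //.
- by apply: denotes_sub; [nia | apply: denotes_mul |].
- by have := PP i ni; lia.
move=> k z kP; apply: denotes_let; first by apply: denotes_add.
apply: denotes_sum => //; [exact: denotes_succ |] => v t vB; apply: denotes_fail => //.
by have := PP i ni; lia.
Qed.

Lemma denotes_badcount L r n c e : r vn = n%:Z -> r vM = (grid n)%:Z ->
  r vK = (mesh n)%:Z -> (mesh n <= L)%N ->
  (2 ^ (2 ^ (n + 6).+1) <= L)%N ->
  (forall b, (b <= n + 6)%N -> (b ^ (2 ^ (n + 6)) < L)%N) ->
  (forall x i, denotes L e (upd (upd r 38%N x) 39%N i) c%:Z) ->
  denotes L (badcount_expr e) r (badcount n c)%:Z.
Proof.
move=> hn hM hK KL PL BL he.
rewrite /badcount -(big_mkord xpredT (fun i => nat_of_bool (isbad n (grid n) (c * mesh n + i)))).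
apply: denotes_sum; [by [] | exact: denotes_var hK | exact: KL |] => k x kK.
apply: (denotes_let (a := (c * mesh n + k)%N%:Z)).
  by apply: denotes_add => //; apply: denotes_mul => //; apply: he.
apply: (denotes_lt (a := 0) (b := (badsum n (grid n) (c * mesh n + k))%:Z)); last by rewrite ltz_nat.
  exact: denotes_cst.
exact: denotes_badsum.
Qed.

(** These quantities control the lengths of all loops in [digit_expr], so the cost of a stage is
    polynomial in [grid n]. *)
Lemma grid_bounds n : [/\ (n + 8 <= grid n)%N, (len (n + 6) <= grid n)%N,
  (mesh n <= grid n)%N, (2 ^ (2 ^ (n + 6).+1) <= grid n)%N &
  forall b, (b <= n + 6)%N -> (b ^ (2 ^ (n + 6)) <= grid n)%N].
Proof.
have f2 : (2 <= (n + 6)`!)%N by apply: dvdn_leq; [exact: fact_gt0 | apply: dvdn_fact; lia].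
have f1 : (n + 6 <= (n + 6)`!)%N by apply: dvdn_leq; [exact: fact_gt0 | apply: dvdn_fact; lia].
have lg : (2 ^ len (n + 6) <= grid n)%N by rewrite gridE leq_exp2r // /len expn_gt0.
have lg' : (len (n + 6) <= grid n)%N by apply: leq_trans (ltnW (ltn_expl _ (ltnSn 1))) lg.
have e1 : (2 ^ (n + 6).+2 <= len (n + 6))%N by rewrite /len leq_exp2l // ltnW // ltn_expl.
split => //.
- have := ltn_expl (n + 6).+2 (ltnSn 1); lia.
- by rewrite -mesh_mul leq_pmulr // expn_gt0.
- by apply: leq_trans lg'; rewrite /len !leq_exp2l.
move=> b bn; rewrite gridE; apply: leq_trans (_ : (n + 6)`! ^ (2 ^ (n + 6)) <= _)%N.
  by rewrite leq_exp2r ?expn_gt0 // (leq_trans bn).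
rewrite leq_exp2l //; apply: leq_trans e1; rewrite leq_exp2l //; lia.
Qed.

(** The loop over end points has [b ^ (2 ^ l) + 1] rounds, hence the bound [(grid n).+1]. *)
Lemma denotes_digit r n A : r vn = n%:Z -> r vA = A%:Z ->
  denotes (grid n).+1 digit_expr r (digit n A : nat)%:Z.
Proof.
move=> hn hA; have [g1 g2 g3 g4 g5] := grid_bounds n.
apply: (denotes_let (a := (n + 6)%N%:Z)); first exact: denotes_add.
apply: (denotes_let (a := (n + 6)`!%:Z)); first by apply: denotes_fact => //; lia.
apply: (denotes_let (a := (len (n + 6))%:Z)).
  have -> : len (n + 6) = (2 ^ (2 ^ (n + 6 + 2)))%N by rewrite /len addn2.
  by apply: denotes_sqs => //; lia.
apply: (denotes_let (a := (grid n)%:Z)).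
  by rewrite {2}gridE; apply: denotes_pow => //; lia.
apply: (denotes_let (a := (mesh n)%:Z)).
  apply: denotes_div => //; apply: denotes_pow => //; [exact: denotes_succ | lia].
have BL b : (b <= n + 6)%N -> (b ^ (2 ^ (n + 6)) < (grid n).+1)%N by move=> /g5.
have c0 r' : r' vA = A%:Z -> denotes (grid n).+1 (Cst 2%N #* vA) r' (2 * A)%N%:Z.
  by move=> h; apply: denotes_mul.
apply: (denotes_lt (a := (badcount n (2 * A).+1)%:Z) (b := (badcount n (2 * A))%:Z));
  last by rewrite ltz_nat.
  apply: denotes_badcount => // [||x i]; [lia | lia |].
  by apply: denotes_succ; apply: c0.
by apply: denotes_badcount => // [||x i]; [lia | lia | apply: c0].
Qed.

(* Register 2 holds 1, and [D] leaves the digit in register 3. *)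
Definition stage (D : cmd) : cmd :=
  Seq D
 (Seq (Emit 3)
 (Seq (Instr (IOp IAdd 1 1 1))
 (Seq (Instr (IOp IAdd 1 1 3))
      (Instr (IOp IAdd 0 0 2))))).

Definition program (D : cmd) : cmd :=
  Seq (Instr (IConst 2 1)) (While 2 (stage D)).

Lemma stage_step D c s s' o (n A : nat) (d : bool) :
  runs D s s' c -> ireg s' 3%N = (d : nat)%:Z ->
  (forall r, (r < 3)%N -> ireg s' r = ireg s r) ->
  ireg s 0%N = n%:Z -> ireg s 1%N = A%:Z -> ireg s 2%N = 1 ->
  exists s'', [/\
    iter (c + 9) step (Config [:: While 2 (stage D)] s o) =
      Config [:: While 2 (stage D)] s'' (rcons o d),
    ireg s'' 0%N = n.+1%:Z, ireg s'' 1%N = (2 * A + d)%N%:Z & ireg s'' 2%N = 1].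
Proof.
move=> hr hd hk s0 s1 s2.
exists (exec (IOp IAdd 0 0 2) (exec (IOp IAdd 1 1 3) (exec (IOp IAdd 1 1 1) s'))); split.
- have tl := runs_seq (runs_instr (IOp IAdd 1 1 1) s')
    (runs_seq (runs_instr (IOp IAdd 1 1 3) _) (runs_instr (IOp IAdd 0 0 2) _)).
  (* Two steps enter the loop body, [c] compute the digit, two emit it and five update the
     registers. *)
  rewrite (_ : (c + 9 = 2 + (c + (2 + 5)))%N); last lia.
  rewrite iter_add iter_add iter_add /stage.
  have -> q : iter 2 step (Config [:: While 2 (Seq D q)] s o) =
      Config [:: D, q & [:: While 2 (Seq D q)]] s o by rewrite /= /step /= s2.
  rewrite hr.
  have e q k : iter 2 step (Config (Seq (Emit 3) q :: k) s' o) =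
      Config (q :: k) s' (rcons o d).
    by rewrite /= /step /=; rewrite hd; case: (d).
  rewrite e.
  exact: tl.
- by rewrite /= !updE /= (hk 0%N) // (hk 2%N) // s0 s2 -PoszD addn1.
- by rewrite /= !updE /= hd !(hk 1%N) // s1 -!PoszD addnn -mul2n.
- by rewrite /= !updE /= (hk 2%N).
Qed.

(** [digit_expr] reads only the registers 0 and 1 from outside; its other variables are bound before
    use, and 0 is a placeholder that keeps the assignment below 3. *)
Definition digit_cmd := compile (fun x => if (x < 3)%N then x else 0%N) 3 digit_expr.

Lemma digit_cmd_cost : exists S : nat, forall s (n A : nat),
  ireg s 0%N = n%:Z -> ireg s 1%N = A%:Z -> exists c s', [/\ runs digit_cmd s s' c,
    (c <= S * (grid n).+2 ^ S)%N, ireg s' 3%N = (digit n A : nat)%:Z &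
    forall r, (r < 3)%N -> ireg s' r = ireg s r].
Proof.
exists (esize digit_expr) => s n A s0 s1.
pose m x := if (x < 3)%N then x else 0%N.
have hm x : (m x < 3)%N by rewrite /m; case: ifP.
have [s' [hr hd hk]] := compileP digit_expr s hm.
have [ll ev] : denotes (grid n).+1 digit_expr (ireg s \o m) (digit n A : nat)%:Z.
  exact: denotes_digit.
exists (cost digit_expr (ireg s \o m)), s'; split => //; first exact: cost_le ll.
by rewrite hd.
Qed.

(** As [grid] grows with the stage, the bound for the last stage serves for all of them. *)
Lemma program_stages : exists S : nat, forall n, exists t s,
  [/\ (t <= n * (S * (grid n).+2 ^ S + 10) + 2)%N,
    iter t step (init (program digit_cmd)) =
      Config [:: While 2 (stage digit_cmd)] s (mkseq dgt n),
    ireg s 0%N = n%:Z, ireg s 1%N = (numer n)%:Z & ireg s 2%N = 1].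
Proof.
have [S hS] := digit_cmd_cost; exists S; move: digit_cmd hS => D hS.
elim=> [|n [t [s [tn E s0 s1 s2]]]].
  by exists 2, (exec (IConst 2 1) (Store (fun=> 0) (fun=> 0) (fun=> [::]))).
have [c [s' [hr hc hd hk]]] := hS s n (numer n) s0 s1.
have [s'' [E' h0 h1 h2]] := stage_step (mkseq dgt n) hr hd hk s0 s1 s2.
exists (t + (c + 9))%N, s''; split => //; last first.
  by rewrite iter_add E E' mkseqS.
have g : (grid n <= grid n.+1)%N by apply: dvdn_leq; [exact: grid_gt0 | exact: grid_dvdS].
have st : (S * (grid n).+2 ^ S <= S * (grid n.+1).+2 ^ S)%N.
  rewrite leq_mul2l; apply/orP; right.
  by case: (posnP S) => [->|S0]; rewrite ?expn0 // leq_exp2r // !ltnS.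
move: st hc tn; move: (S * _)%N (S * _)%N => x y xy cx tn; nia.
Qed.

Lemma computes_normal_number (R : realType) : computes (program digit_cmd) (normal_number R).
Proof.
exists dgt; first exact: normal_number_expansion.
move=> n; have [S hS] := program_stages; have [t [s [_ E _ _ _]]] := hS n.
by exists t; rewrite /output_after E.
Qed.

(** * The triple-exponential time bound *)

Lemma fact_le_expn m : (m`! <= m ^ m)%N.
Proof.
elim: m => // -[|k] IH //; rewrite factS expnS leq_mul2l /=.
by apply: leq_trans IH _; rewrite leq_exp2r.
Qed.

(** With [m = n + 6], the factorial is at most [2 ^ (m * m)] and [m * m <= len m], so the grid has
    at most [2 ^ (len m * len m) = 2 ^ (2 ^ (2 ^ m.+3))] points; one more exponent absorbs the added
    2. *)
Lemma grid_le n : ((grid n).+2 <= 2 ^ (2 ^ (2 ^ (n + 10))))%N.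
Proof.
set m := (n + 6)%N; have m2 : (2 <= m)%N by rewrite /m; lia.
have f : (m`! <= 2 ^ (m * m))%N.
  apply: leq_trans (fact_le_expn m) _; rewrite expnM leq_exp2r; last lia.
  by apply: ltnW; apply: ltn_expl.
have mm : (m * m <= len m)%N.
  apply: leq_trans (_ : 2 ^ m * 2 ^ m <= _)%N.
    by apply: leq_mul; apply: ltnW; apply: ltn_expl.
  rewrite -expnD addnn -mul2n /len leq_exp2l //.
  have := ltn_expl m (ltnSn 1); rewrite !expnS; lia.
have gr : (grid n <= 2 ^ (2 ^ (2 ^ m.+3)))%N.
  rewrite gridE -/m; apply: leq_trans (_ : (2 ^ (m * m)) ^ len m <= _)%N.
    by rewrite leq_exp2r // /len expn_gt0.
  rewrite -expnM leq_exp2l //; apply: leq_trans (_ : len m * len m <= _)%N.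
    by rewrite leq_mul2r mm orbT.
  by rewrite /len -expnD leq_exp2l // addnn -mul2n -expnS.
have -> : (2 ^ (2 ^ (n + 10)) = 2 ^ (2 ^ m.+3) * 2 ^ (2 ^ m.+3))%N.
  by rewrite -expnD addnn -mul2n -expnS; congr (2 ^ (2 ^ _))%N; rewrite /m; lia.
have K2 : (2 <= 2 ^ (2 ^ m.+3))%N by rewrite -{1}(expn1 2) leq_exp2l // expn_gt0.
move: gr K2; move: (2 ^ (2 ^ m.+3))%N => K gr K2.
apply: leq_trans (_ : 2 ^ K.+1 <= _)%N; last by rewrite leq_exp2l //; nia.
have : (K < 2 ^ K)%N by apply: ltn_expl.
rewrite expnS; lia.
Qed.

(** A polynomial of degree [S] only enlarges the innermost exponent, to [n + 10 + (2 * S + 1)],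
    which is at most [(12 + 2 * S) * n] for [n >= 1]. *)
Lemma time_bound S n : (1 <= n)%N ->
  (n * (S * (grid n).+2 ^ S + 10) + 2 <= 2 ^ (2 ^ (2 ^ ((12 + 2 * S) * n))))%N.
Proof.
move=> n1; have := grid_le n; set W := (2 ^ (2 ^ (n + 10)))%N => gW.
have two k : (k < 2 ^ k)%N by apply: ltn_expl.
have nW : (n + 6 <= W)%N.
  apply: leq_trans (_ : n + 10 <= _)%N; first lia.
  by apply: leq_trans (ltnW (two _)) _; rewrite leq_exp2l // ltnW.
have h1 : (S * (grid n).+2 ^ S <= 2 ^ (S + W * S))%N.
  rewrite expnD expnM; apply: leq_mul; first exact: ltnW.
  by case: (S) => [|S']; rewrite ?expn0 // leq_exp2r.
have h2 : (n * (S * (grid n).+2 ^ S + 10) + 2 <= 2 ^ (n + (S + W * S) + 5))%N.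
  rewrite expnD expnD; move: h1 (two n) (expn_gt0 2 (S + W * S)).
  by move: (2 ^ (S + W * S))%N (S * _)%N (2 ^ n)%N => x y z /=; nia.
apply: leq_trans h2 _; rewrite leq_exp2l //.
apply: leq_trans (_ : W * 2 ^ (2 * S + 1) <= _)%N.
  apply: leq_trans (_ : W * (2 * S + 1) <= _)%N; first by nia.
  by rewrite leq_mul2l ltnW ?orbT.
rewrite /W -expnD leq_exp2l //.
apply: leq_trans (_ : 2 ^ (n + 10) * 2 ^ (2 * S + 1) <= _)%N.
  have := two (2 * S + 1)%N; have : (0 < 2 ^ (n + 10))%N by rewrite expn_gt0.
  by move: (2 ^ _)%N (2 ^ _)%N => x y; nia.
by rewrite -expnD leq_exp2l //; nia.
Qed.

Lemma program_time (R : realType) : triple_exp_time R (program digit_cmd).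
Proof.
have [S hS] := program_stages; exists (12 + 2 * S)%N%:R; first by rewrite ltr0n.
move=> n n1; have [t [s [tn E _ _ _]]] := hS n.
exists t; last by rewrite /output_after E size_mkseq.
rewrite -natrM; do 3 (rewrite powR_mulrn // -natrX); rewrite ler_nat.
exact: leq_trans tn (time_bound S n1).
Qed.

Theorem theorem1 (R : realType) :
  exists (p : cmd) (x : R),
    [/\ computes p x,
        forall b : nat, (2 <= b)%N ->
          (limn_esup (fun N : nat =>
             (discrepancy N (fun j : nat => frac_part (b%:R ^+ j * x))
                * Num.sqrt N%:R / Num.sqrt (ln (ln N%:R)))%:E)
           < (3 * lil_const R b)%:E)%E
      & triple_exp_time R p].
Proof.
exists (program digit_cmd), (normal_number R); split.
- exact: computes_normal_number.
- exact: lil.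
- exact: program_time.
Qed.
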